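(* For every $w\in W$, $$\mathrm{fin}(K_w)=\mathrm{EQB}(w),\qquad\text{where}\quad \mathrm{fin}(K_w)=\bigl\{u\in W\mid ut_\xi\in K_w\text{ for some }\xi\in Q^\vee\bigr\}.$$
   Context: $\mathfrak g$ is a finite-dimensional simple Lie algebra over $\mathbb C$ with simple roots $\alpha_i$ ($i\in I$), root system $\Delta$, positive roots $\Delta^+$, coroots $\beta^\vee$, coroot lattice $Q^\vee=\bigoplus_{i}\mathbb Z\alpha_i^\vee$, $\rho=\frac12\sum_{\alpha\in\Delta^+}\alpha$. $W=\langle s_i\mid i\in I\rangle$ is its Weyl group with length function $\ell$, longest element $w_\circ$ and Bruhat order $<$. $W_{\rm af}=W\ltimes\{t_\xi\mid\xi\in Q^\vee\}$ is the affine Weyl group of the untwisted affine Lie algebra $\mathfrak g_{\rm af}$; the positive real roots of $\mathfrak g_{\rm af}$ are $\Delta^+_{\rm af}=\Delta^+\sqcup\{\alpha+n\delta\mid\alpha\in\Delta,\ n\in\mathbb Z_{>0}\}$, and the reflection in $\beta=\alpha+n\delta$ is $s_\beta=s_\alpha t_{n\alpha^\vee}$. Semi-infinite Bruhat order: for $x=wt_\xi$ ($w\in W,\xi\in Q^\vee$) put $\ell^{\frac\infty2}(x)=\ell(w)+2\langle\rho,\xi\rangle$. Put an edge $x\xrightarrow{\beta}y$ ($\beta\in\Delta^+_{\rm af}$) if $y=s_\beta x$ and $\ell^{\frac\infty2}(y)=\ell^{\frac\infty2}(x)+1$. Write $x\preceq y$ if there is a directed path from $x$ to $y$. Let $(W_{\rm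 af})_{\succeq x}=\{y\in W_{\rm af}\mid y\succeq x\}$. For $w\in W$, $$K_w=(W_{\rm af})_{\succeq w}\setminus\bigcup_{z\in W,\ z>w}(W_{\rm af})_{\succeq z}.$$ Quantum Bruhat graph $\mathrm{QBG}(W)$: vertices $W$; edges $u\xrightarrow{\beta}v$, $\beta\in\Delta^+$, $v=us_\beta$, with $\ell(v)=\ell(u)+1$ or $\ell(v)=\ell(u)+1-2\langle\rho,\beta^\vee\rangle$. Definition of $\mathrm{EQB}(w)$: fix a reduced expression $w=s_{i_1}\cdots s_{i_p}$ and choose $i_{-m},\dots,i_0\in I$ such that $s_{i_{-m}}\cdots s_{i_0}s_{i_1}\cdots s_{i_p}$ is a reduced expression for $w_\circ$. Put $\beta_k=s_{i_p}\cdots s_{i_{k+1}}\alpha_{i_k}\in\Delta^+$ for $-m\le k\le p$. For each $u\in W$ there is a unique shortest directed path $w=x_0\xrightarrow{\beta_{j_1}}\cdots\xrightarrow{\beta_{j_s}}x_s=u$ in $\mathrm{QBG}(W)$ with $-m\le j_1<\cdots<j_s\le p$ (the label-increasing path). $\mathrm{EQB}(w)$ is the set of all $u\in W$ whose label-increasing path from $w$ satisfies $j_1\ge1$ (vacuous if $u=w$); it does not depend on the choice of the reduced expression of $w$. *)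

(* Defs.v *)
From HB Require Import structures.
From Stdlib Require Import Relation_Operators.
From mathcomp Require Import all_boot all_order all_algebra.
From mathcomp Require Import boolp classical_sets.

Set Implicit Arguments.
Unset Strict Implicit.
Unset Printing Implicit Defensive.

Import Order.TTheory GRing.Theory Num.Theory.

Local Open Scope classical_set_scope.
Local Open Scope ring_scope.

(* A finite-dimensional simple Lie algebra over C enters only through its root
   system, an irreducible reduced crystallographic root system with a chosen
   base.  The real span of the roots is the Euclidean space 'cV[R]_n (n = rank,
   I = 'I_n); the inner product identifies it with the real span of the
   coroots, so a^\vee = 2a/(a,a) and the pairing is the inner product.
   Matrices act on column vectors from the left. *)

Section RootSystem.
Variables (R : realFieldType) (n : nat).
Implicit Types (a b x y : 'cV[R]_n) (Phi : seq 'cV[R]_n).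

Definition dot x y : R := (x^T *m y) 0 0.

Definition coroot a : 'cV[R]_n := (2 / dot a a) *: a.

Definition refl a : 'M[R]_n := 1%:M - a *m (coroot a)^T.

Record root_system Phi : Prop := RootSystem {
  rs_uniq : uniq Phi;
  rs_span : <<Phi>>%VS = fullv;
  rs_neq0 : 0 \notin Phi;
  rs_refl : forall a b, a \in Phi -> b \in Phi -> refl a *m b \in Phi;
  rs_int : forall a b, a \in Phi -> b \in Phi ->
    exists m : int, dot b (coroot a) = m%:~R;
  rs_reduced : forall a (c : R), a \in Phi -> c *: a \in Phi ->
    c = 1 \/ c = -1
}.

Definition irreducible_root_system Phi : Prop :=
  Phi <> [::] /\
  forall P : pred 'cV[R]_n,
    {in Phi &, forall a b, P a -> ~~ P b -> dot a b = 0} ->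
    {in Phi, forall a, P a} \/ {in Phi, forall a, ~~ P a}.

Variable alpha : 'I_n -> 'cV[R]_n.

Definition nonneg_comb x : Prop :=
  exists c : 'I_n -> nat, x = \sum_i (c i)%:R *: alpha i.

Record root_base Phi : Prop := RootBase {
  rb_mem : forall i, alpha i \in Phi;
  rb_basis : basis_of fullv (codom alpha);
  rb_sign : forall a, a \in Phi -> nonneg_comb a \/ nonneg_comb (- a)
}.

Definition pos_roots Phi : seq 'cV[R]_n := [seq a <- Phi | `[< nonneg_comb a >]].

Definition rho Phi : 'cV[R]_n := 2^-1 *: \sum_(a <- pos_roots Phi) a.

Definition coroot_lattice : set 'cV[R]_n :=
  [set xi | exists c : 'I_n -> int, xi = \sum_i (c i)%:~R *: coroot (alpha i)].

Definition word_prod (s : seq 'I_n) : 'M[R]_n := \prod_(i <- s) refl (alpha i).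

(* Simple reflections are involutions, so words in them exhaust the group
   they generate. *)
Definition weyl : set 'M[R]_n := range word_prod.

(* Junk value 0 outside weyl. *)
Definition len (w : 'M[R]_n) : nat :=
  xget 0%N [set k | (exists2 s, word_prod s = w & size s = k) /\
                    forall s, word_prod s = w -> (k <= size s)%N].

Definition reduced_expr (w : 'M[R]_n) (s : seq 'I_n) : Prop :=
  word_prod s = w /\ size s = len w.

Definition longest (w0 : 'M[R]_n) : Prop :=
  weyl w0 /\ forall w, weyl w -> (len w <= len w0)%N.

Variable Phi : seq 'cV[R]_n.

Definition bruhat_step (u v : 'M[R]_n) : Prop :=
  exists2 b, b \in pos_roots Phi & v = refl b *m u /\ (len u < len v)%N.

Definition bruhat_lt (u v : 'M[R]_n) : Prop := clos_trans _ bruhat_step u v.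

(* The pair (w, xi) stands for w t_xi; the product below is the one of the
   semidirect product, w t_xi v t_zeta = w v t_{v^-1 xi + zeta}. *)
Definition affine : Type := ('M[R]_n * 'cV[R]_n)%type.

Definition weyl_af : set affine := [set x | weyl x.1 /\ coroot_lattice x.2].

Definition af_mul (x y : affine) : affine :=
  (x.1 *m y.1, invmx y.1 *m x.2 + y.2).

(* The pair (a, k) stands for the affine root a + k delta. *)
Definition pos_af (b : 'cV[R]_n * nat) : Prop :=
  (b.1 \in pos_roots Phi /\ b.2 = 0%N) \/ (b.1 \in Phi /\ (0 < b.2)%N).

Definition refl_af (b : 'cV[R]_n * nat) : affine :=
  (refl b.1, b.2%:R *: coroot b.1).

Definition si_len (x : affine) : R := (len x.1)%:R + 2 * dot (rho Phi) x.2.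

Definition si_edge (x y : affine) : Prop :=
  exists2 b, pos_af b & y = af_mul (refl_af b) x /\ si_len y = si_len x + 1.

Definition si_le (x y : affine) : Prop := clos_refl_trans _ si_edge x y.

Definition si_up (x : affine) : set affine :=
  [set y | weyl_af y /\ si_le x y].

Definition Kset (w : 'M[R]_n) : set affine :=
  si_up (w, 0) `\`
  \bigcup_(z in [set z | weyl z /\ bruhat_lt w z]) si_up (z, 0).

Definition fin_part (K : set affine) : set 'M[R]_n :=
  [set u | weyl u /\ exists2 xi, coroot_lattice xi & K (u, xi)].

Definition qbg_edge (u : 'M[R]_n) (b : 'cV[R]_n) (v : 'M[R]_n) : Prop :=
  [/\ b \in pos_roots Phi, v = u *m refl b &
      (len v)%:R = (len u)%:R + 1 :> R \/
      (len v)%:R = (len u)%:R + 1 - 2 * dot (rho Phi) (coroot b)].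

Fixpoint qbg_path (u : 'M[R]_n) (p : seq 'cV[R]_n) (v : 'M[R]_n) : Prop :=
  if p is b :: p' then exists2 x, qbg_edge u b x & qbg_path x p' v else u = v.

Definition qbg_shortest (u : 'M[R]_n) (p : seq 'cV[R]_n) (v : 'M[R]_n) : Prop :=
  qbg_path u p v /\ forall q, qbg_path u q v -> (size p <= size q)%N.

(* The roots s_{i_p} ... s_{i_(k+1)} alpha_{i_k} attached to a word
   i_1 ... i_p, listed by increasing k. *)
Fixpoint word_roots (s : seq 'I_n) : seq 'cV[R]_n :=
  if s is i :: s' then (word_prod (rev s') *m alpha i) :: word_roots s' else [::].

(* Labels are counted from 0 along the word pre ++ red, where pre is
   i_{-m} ... i_0 and red is i_1 ... i_p; hence the label j >= 1 of the usual
   numbering becomes size pre <= j.  The label-increasing shortest path from w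
   to u exists and is unique when pre ++ red is reduced for the longest
   element. *)
Definition label_increasing_path (pre red : seq 'I_n) (w u : 'M[R]_n)
    (js : seq nat) : Prop :=
  [/\ sorted ltn js, all (fun j => j < size (pre ++ red))%N js &
      qbg_shortest w [seq nth 0 (word_roots (pre ++ red)) j | j <- js] u].

Definition EQB (pre red : seq 'I_n) (w : 'M[R]_n) : set 'M[R]_n :=
  [set u | weyl u /\
     exists2 js, label_increasing_path pre red w u js &
                 if js is j1 :: _ then (size pre <= j1)%N else True].

End RootSystem.

(* Main.v *)
Require Import Defs.
From Stdlib Require Import Relation_Operators.
From mathcomp Require Import all_boot all_order all_algebra.
From mathcomp Require Import boolp classical_sets.
From mathcomp Require Import zify ring lra.

Set Implicit Arguments.
Unset Strict Implicit.
Unset Printing Implicit Defensive.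

Import Order.TTheory GRing.Theory Num.Theory.

Local Open Scope ring_scope.

(** Through the labels w^-1 beta, the semi-infinite order consists of the paths in the
   quantum Bruhat graph (lemma si_edgeP): the edges at (w, xi) lead to (w s_g, xi + c g^v), where
   w -> w s_g is an edge of the graph and c is 0 for a Bruhat edge, 1 for a quantum
   edge.  The semi-infinite length of (w, xi) grows by one along each edge, so a path of
   minimal weight from w to u is a shortest one.  Two facts about the graph are needed.

   First, between any two elements there is exactly one path whose labels increase for
   the reflection order of a reduced word of w0, it is a shortest path, and the weights
   of all paths from w to u form a translate, by the weight of the shortest ones, of the
   set S0 of weights of closed paths.  Both are proved by moving the pair (w, u) with the
   simple reflections of the affine Weyl group, acting on the left.  On the order they
   act by the lifting property (lemma lifting).  On the number of increasing paths they act by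
   lemma cnt_sr, a commutation of the operators 1 + 2 Q_g, with Q_g the sum of the edges
   labelled g, with a 0-Hecke action; it is checked one label at a time from the diamond
   lemmas edge_flip and edge_cross, and holds for the labels of any final segment of the
   word.  These moves connect all pairs (lemmas reach1 and pair_ind), and from 1 to w0 there
   is no room for a second increasing path (lemma F11).

   Secondly, write the word of w0 as s ++ t with w the product of t.  The labels attached
   to t are the inversions of w, the other labels lead from w to Bruhat covers.  If the
   increasing path from w to u starts with one of the latter, a shortest path from w to u
   passes through a cover z of w, so all (u, xi) above (w, 0) are above (z, 0) and u is
   not in the finite part of K_w (lemma Kset_cnt).  Otherwise no shortest path from w to u starts
   with a Bruhat edge (lemma no_bruhat_cover, again from cnt_sr), and (u, xi) with xi of
   minimal weight is above no z > w, because such a z is joined to w by a chain of covers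
   (lemma cnt_Kset). *)

(** * Reflections in Euclidean space *)

Section Euclid.
Variables (R : realFieldType) (n : nat).
Implicit Types (a b x y : 'cV[R]_n) (A w : 'M[R]_n).

Lemma dotE x y : dot x y = \sum_i x i 0 * y i 0.
Proof. by rewrite /dot mxE; apply: eq_bigr => i _; rewrite mxE. Qed.

Lemma dotC x y : dot x y = dot y x.
Proof. by rewrite !dotE; apply: eq_bigr => i _; rewrite mulrC. Qed.

Lemma dotDl x y b : dot (x + y) b = dot x b + dot y b.
Proof. by rewrite /dot linearD mulmxDl mxE. Qed.

Lemma dotNl x b : dot (- x) b = - dot x b.
Proof. by rewrite /dot linearN mulNmx mxE. Qed.

Lemma dotZl c x b : dot (c *: x) b = c * dot x b.
Proof. by rewrite /dot linearZ -scalemxAl mxE. Qed.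

Lemma dot0l b : dot 0 b = 0.
Proof. by rewrite -(scale0r 0) dotZl mul0r. Qed.

Lemma dotDr b x y : dot b (x + y) = dot b x + dot b y.
Proof. by rewrite dotC dotDl !(dotC b). Qed.

Lemma dotNr b x : dot b (- x) = - dot b x.
Proof. by rewrite dotC dotNl dotC. Qed.

Lemma dotZr b c x : dot b (c *: x) = c * dot b x.
Proof. by rewrite dotC dotZl dotC. Qed.

Lemma dot0r b : dot b 0 = 0.
Proof. by rewrite dotC dot0l. Qed.

Lemma dot_sumr (I : Type) (r : seq I) (P : pred I) (F : I -> 'cV[R]_n) b :
  dot b (\sum_(i <- r | P i) F i) = \sum_(i <- r | P i) dot b (F i).
Proof. by elim/big_rec2: _ => [|i u v _ <-]; rewrite ?dot0r ?dotDr. Qed.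

Lemma dot_suml (I : Type) (r : seq I) (P : pred I) (F : I -> 'cV[R]_n) b :
  dot (\sum_(i <- r | P i) F i) b = \sum_(i <- r | P i) dot (F i) b.
Proof. by rewrite dotC dot_sumr; apply: eq_bigr => i _; rewrite dotC. Qed.

Lemma dot_ge0 x : 0 <= dot x x.
Proof. by rewrite dotE sumr_ge0 // => i _; rewrite -expr2 sqr_ge0. Qed.

Lemma dot_eq0 x : (dot x x == 0) = (x == 0).
Proof.
apply/idP/eqP => [|->]; last by rewrite dot0l.
rewrite dotE psumr_eq0 => [/allP h|i _]; last by rewrite -expr2 sqr_ge0.
apply/matrixP => i j; rewrite ord1 mxE.
by have := h i (mem_index_enum i); rewrite -expr2 sqrf_eq0 => /eqP.
Qed.

Lemma dot_gt0 x : x != 0 -> 0 < dot x x.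
Proof. by rewrite lt_def dot_ge0 andbT dot_eq0. Qed.

Lemma dot_mulmx A x y : dot (A *m x) y = dot x (A^T *m y).
Proof. by rewrite /dot trmx_mul mulmxA. Qed.

Lemma corootN a : coroot (- a) = - coroot a.
Proof. by rewrite /coroot dotNl dotNr opprK scalerN. Qed.

Lemma dot_coroot_self a : a != 0 -> dot a (coroot a) = 2.
Proof.
by move=> a0; rewrite dotZr mulfVK // dot_eq0.
Qed.

Lemma reflE a x : refl a *m x = x - dot x (coroot a) *: a.
Proof.
rewrite /refl mulmxBl mul1mx; congr (_ - _).
rewrite -mulmxA dotC /dot.
by rewrite [X in a *m X]mx11_scalar mul_mx_scalar.
Qed.

Lemma trmx_refl a : (refl a)^T = refl a.
Proof.
rewrite /refl linearB /= trmx1; congr (_ - _).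
by rewrite trmx_mul trmxK /coroot linearZ /= -scalemxAl -scalemxAr.
Qed.

Lemma mx_ext (A B : 'M[R]_n) : (forall x : 'cV[R]_n, A *m x = B *m x) -> A = B.
Proof.
move=> h; apply/matrixP => i j.
by have /matrixP/(_ i 0) := h (delta_mx j 0); rewrite -!colE !mxE.
Qed.

Lemma reflK a : a != 0 -> refl a *m refl a = 1%:M.
Proof.
move=> a0; apply: mx_ext => x; rewrite mul1mx -mulmxA !reflE dotDl dotNl dotZl.
rewrite dot_coroot_self // -addrA -opprD -scalerDl.
have -> : dot x (coroot a) + (dot x (coroot a) - dot x (coroot a) * 2) = 0.
  by ring.
by rewrite scale0r subr0.
Qed.

Lemma refl_self a : a != 0 -> refl a *m a = - a.
Proof.
by move=> a0; rewrite reflE dot_coroot_self // scaler_nat mulr2n opprD addNKr.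
Qed.

Lemma reflN a : refl (- a) = refl a.
Proof. by rewrite /refl corootN linearN mulmxN mulNmx opprK. Qed.

Definition orthog w := w^T *m w = 1%:M.

Lemma orthog_trK w : orthog w -> w *m w^T = 1%:M.
Proof. exact: mulmx1C. Qed.

Lemma orthogM v w : orthog v -> orthog w -> orthog (v *m w).
Proof.
by rewrite /orthog trmx_mul -mulmxA => hv hw; rewrite (mulmxA v^T) hv mul1mx.
Qed.

Lemma orthog_tr w : orthog w -> orthog w^T.
Proof. by move=> h; rewrite /orthog trmxK orthog_trK. Qed.

Lemma orthog1 : orthog 1%:M.
Proof. by rewrite /orthog trmx1 mul1mx. Qed.

Lemma orthog_refl a : a != 0 -> orthog (refl a).
Proof. by move=> a0; rewrite /orthog trmx_refl reflK. Qed.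

Lemma orthog_inv w : orthog w -> invmx w = w^T.
Proof.
move=> h; have [_ u] := mulmx1_unit h.
have e : w^T *m w = 1%:M by [].
by rewrite -[LHS]mul1mx -e mulmxK.
Qed.

Lemma orthogK w x : orthog w -> w^T *m (w *m x) = x.
Proof. by move=> h; rewrite mulmxA h mul1mx. Qed.

Lemma orthogKV w x : orthog w -> w *m (w^T *m x) = x.
Proof. by move=> h; rewrite mulmxA orthog_trK // mul1mx. Qed.

Lemma dot_orthog w x y : orthog w -> dot (w *m x) (w *m y) = dot x y.
Proof. by move=> h; rewrite dot_mulmx orthogK. Qed.

Lemma coroot_orthog w a : orthog w -> coroot (w *m a) = w *m coroot a.
Proof. by move=> h; rewrite /coroot dot_orthog // scalemxAr. Qed.

Lemma refl_orthog w a : orthog w -> refl (w *m a) *m w = w *m refl a.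
Proof.
move=> h; apply: mx_ext => x; rewrite -!mulmxA !reflE.
by rewrite coroot_orthog // dot_orthog // mulmxBr -scalemxAr.
Qed.

Lemma dot_coroot_gt0 x a : a != 0 -> (0 < dot x (coroot a)) = (0 < dot x a).
Proof.
by move=> a0; rewrite dotZr pmulr_rgt0 // divr_gt0 ?ltr0n // dot_gt0.
Qed.

Lemma sum_involution (T : eqType) (f : T -> T) (F : T -> R) (r : seq T) :
  uniq r -> involutive f -> {in r, forall z, f z \in r} ->
  (forall z, F (f z) = - F z) -> \sum_(z <- r) F z = 0.
Proof.
move=> ur fK fr Ff; set A := \sum_(z <- r) F z.
suff : A = - A by lra.
have hp : perm_eq r (map f r).
  apply: uniq_perm; rewrite ?map_inj_uniq //; first exact: inv_inj.
  move=> z; rewrite -{2}(fK z) mem_map; last exact: inv_inj.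
  by apply/idP/idP => /fr; rewrite ?fK.
rewrite {1}/A (perm_big _ hp) big_map -sumrN.
by apply: eq_bigr => z _; rewrite Ff.
Qed.

End Euclid.

Section Weyl.
Variables (R : realFieldType) (n : nat).
Variables (Phi : seq 'cV[R]_n) (alpha : 'I_n -> 'cV[R]_n).
Hypotheses (hPhi : root_system Phi) (hbase : root_base alpha Phi).
Implicit Types (a b g : 'cV[R]_n) (u v w x y z : 'M[R]_n) (s t : seq 'I_n).
Implicit Types (i j : 'I_n).

Notation Pos := (pos_roots alpha Phi).
Notation len := (len alpha).
Notation weyl := (weyl alpha).
Notation wp := (word_prod alpha).

(** * Positive roots *)

Lemma root_neq0 a : a \in Phi -> a != 0.
Proof. by move=> ha; apply: contraNneq (rs_neq0 hPhi) => <-. Qed.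

Lemma rootN a : a \in Phi -> - a \in Phi.
Proof. by move=> ha; rewrite -refl_self ?root_neq0 // (rs_refl hPhi). Qed.

Lemma posP a : reflect (a \in Phi /\ nonneg_comb alpha a) (a \in Pos).
Proof.
rewrite mem_filter; apply: (iffP andP) => [[/asboolP]|[h1 h2]] //.
by split=> //; apply/asboolP.
Qed.

Lemma pos_root a : a \in Pos -> a \in Phi.
Proof. by case/posP. Qed.

Lemma pos_neq0 a : a \in Pos -> a != 0.
Proof. by move/pos_root/root_neq0. Qed.

Lemma pos_uniq : uniq Pos.
Proof. by rewrite filter_uniq // (rs_uniq hPhi). Qed.

Lemma alpha_free (c : 'I_n -> R) : \sum_i c i *: alpha i = 0 -> forall i, c i = 0.
Proof.
have := basis_free (rb_basis hbase).
have -> : codom alpha = codom_tuple alpha by [].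
move=> /freeP hf h0 i.
have key : \sum_(k < #|'I_n|) c (enum_val k) *: (codom_tuple alpha)`_k = 0.
  rewrite -[RHS]h0 (reindex (fun k : 'I_#|'I_n| => enum_val k)) /=; last first.
    by apply: onW_bij; apply: enum_val_bij.
  apply: eq_bigr => k _; congr (_ *: _).
  have hk : (k < size (codom alpha))%N by rewrite size_codom.
  by rewrite /= /codom /image_mem (nth_map i) -?cardE // -enum_val_nth.
by have := hf (fun k => c (enum_val k)) key (enum_rank i); rewrite enum_rankK.
Qed.

Lemma posN a : a \in Pos -> - a \notin Pos.
Proof.
move=> ha; apply/negP => /posP[_ [d hd]]; have /posP[_ [c hc]] := ha.
have := pos_neq0 ha; rewrite hc.
have e : \sum_i ((c i)%:R + (d i)%:R) *: alpha i = 0.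
  rewrite (eq_bigr (fun i => (c i)%:R *: alpha i + (d i)%:R *: alpha i)).
    by rewrite big_split /= -hc -hd subrr.
  by move=> i _; rewrite scalerDl.
rewrite big1 ?eqxx // => i _.
have := alpha_free e i; rewrite -natrD => /eqP.
by rewrite pnatr_eq0 addn_eq0 => /andP[/eqP-> _]; rewrite scale0r.
Qed.

Lemma negE a : a \in Phi -> (- a \in Pos) = (a \notin Pos).
Proof.
move=> ha; case: (boolP (a \in Pos)) => [/posN/negbTE-> //|na].
case: (rb_sign hbase ha) => h; last by apply/posP; split=> //; apply: rootN.
by move/posP: na; case.
Qed.

Lemma alpha_pos i : alpha i \in Pos.
Proof.
apply/posP; split; first exact: (rb_mem hbase).
exists (fun j => (j == i)%N); rewrite (bigD1 i) //= eqxx scale1r big1 ?addr0 //.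
by move=> j /negbTE->; rewrite scale0r.
Qed.

Lemma alpha_neq0 i : alpha i != 0.
Proof. exact: pos_neq0 (alpha_pos i). Qed.

(** A positive root other than a simple one involves a second simple root, whose
   coefficient no multiple of the first can change. *)
Lemma simple_refl_pos i b :
  b \in Pos -> b != alpha i -> refl (alpha i) *m b \in Pos.
Proof.
move=> hb bi; have /posP[hbP [c hc]] := hb.
have hr : refl (alpha i) *m b \in Phi.
  by apply: (rs_refl hPhi) => //; exact: (rb_mem hbase).
rewrite -[_ \in _]negbK -negE //; apply/negP => /posP[_ [d hd]].
have e : \sum_j ((c j)%:R + (d j)%:R - dot b (coroot (alpha i)) * (j == i)%:R)
         *: alpha j = 0.
  rewrite (eq_bigr (fun j => (c j)%:R *: alpha j + (d j)%:R *: alpha j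
     - (dot b (coroot (alpha i)) * (j == i)%:R) *: alpha j)); last first.
    by move=> j _; rewrite scalerBl scalerDl.
  rewrite sumrB big_split /= -hc -hd reflE (bigD1 i) //= big1 => [|j /negbTE->].
    by rewrite eqxx mulr1 addr0 opprB addrCA subrr addr0 subrr.
  by rewrite mulr0 scale0r.
have cj j : j != i -> c j = 0%N.
  move=> ji; have /eqP := alpha_free e j.
  rewrite (negbTE ji) mulr0 subr0 -natrD pnatr_eq0 addn_eq0.
  by case/andP => /eqP.
have hb' : b = (c i)%:R *: alpha i.
  by rewrite hc (bigD1 i) //= big1 ?addr0 // => j /cj->; rewrite scale0r.
have h1 : (c i)%:R *: alpha i \in Phi by rewrite -hb'.
case: (rs_reduced hPhi (rb_mem hbase i) h1) => ci.
  by rewrite hb' ci scale1r eqxx in bi.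
have := posN (alpha_pos i); rewrite -scaleN1r -ci -hb'.
by rewrite hb.
Qed.

(** * Words and the Weyl group *)

Lemma word_nil : wp [::] = 1%:M.
Proof. by rewrite /word_prod big_nil. Qed.

Lemma word_cons i s : wp (i :: s) = refl (alpha i) *m wp s.
Proof. by rewrite /word_prod big_cons. Qed.

Lemma word_cat s t : wp (s ++ t) = wp s *m wp t.
Proof. by elim: s => [|i s IH]; rewrite ?word_nil ?mul1mx //= !word_cons IH mulmxA. Qed.

Lemma word_orthog s : orthog (wp s).
Proof.
elim: s => [|i s IH]; first by rewrite word_nil; exact: orthog1.
by rewrite word_cons; apply: orthogM => //; apply: orthog_refl (alpha_neq0 i).
Qed.

Lemma word_rev s : wp (rev s) = (wp s)^T.
Proof.
elim: s => [|i s IH]; first by rewrite word_nil trmx1.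
by rewrite rev_cons -cats1 word_cat !word_cons word_nil mulmx1 trmx_mul trmx_refl IH.
Qed.

Lemma weylP w : weyl w <-> exists s, wp s = w.
Proof. by split=> [[s _ <-]|[s <-]]; exists s. Qed.

Lemma weyl_word s : weyl (wp s).
Proof. by apply/weylP; exists s. Qed.

Lemma weyl1 : weyl 1%:M.
Proof. by rewrite -word_nil; apply: weyl_word. Qed.

Lemma weylM v w : weyl v -> weyl w -> weyl (v *m w).
Proof.
by move=> /weylP[s <-] /weylP[t <-]; rewrite -word_cat; apply: weyl_word.
Qed.

Lemma weyl_tr w : weyl w -> weyl w^T.
Proof. by move=> /weylP[s <-]; rewrite -word_rev; apply: weyl_word. Qed.

Lemma weyl_simple i : weyl (refl (alpha i)).
Proof. by rewrite -[refl _]mulmx1 -word_nil -word_cons; apply: weyl_word. Qed.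

Lemma weyl_orthog w : weyl w -> orthog w.
Proof. by move=> /weylP[s <-]; apply: word_orthog. Qed.

Lemma weyl_root w a : weyl w -> a \in Phi -> w *m a \in Phi.
Proof.
move=> /weylP[s <-] ha; elim: s => [|i s IH]; first by rewrite word_nil mul1mx.
by rewrite word_cons -mulmxA; apply: (rs_refl hPhi) => //; exact: (rb_mem hbase).
Qed.

Lemma weyl_rootT w a : weyl w -> a \in Phi -> w^T *m a \in Phi.
Proof. by move/weyl_tr; apply: weyl_root. Qed.

Lemma simpleK i : refl (alpha i) *m refl (alpha i) = 1%:M.
Proof. exact: reflK (alpha_neq0 i). Qed.

Lemma simpleMK m i (w : 'M[R]_(n, m)) : refl (alpha i) *m (refl (alpha i) *m w) = w.
Proof. by rewrite mulmxA simpleK mul1mx. Qed.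

(** By induction along the word: the letter to delete is the one whose reflection
   first turns the image of b negative, at which point that image is simple. *)
Lemma exchange b s : b \in Pos -> (wp s)^T *m b \notin Pos ->
  exists2 t, wp t = refl b *m wp s & size s = (size t).+1.
Proof.
elim: s b => [|i s IH] b hb; first by rewrite word_nil trmx1 mul1mx hb.
rewrite word_cons trmx_mul trmx_refl -mulmxA => h.
have [->|bi] := eqVneq b (alpha i).
  by exists s => //; rewrite simpleMK.
have [t ht hs] := IH _ (simple_refl_pos hb bi) h.
exists (i :: t); last by rewrite /= hs.
rewrite word_cons ht mulmxA -refl_orthog; last exact: weyl_orthog (weyl_simple i).
by rewrite simpleMK mulmxA.
Qed.

(** The number of inversions, which lemma lenE identifies with the length. *)
Definition inv w : nat := count (fun b => w *m b \notin Pos) Pos.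

Lemma inv_simple i w : weyl w -> w^T *m alpha i \in Pos ->
  inv (refl (alpha i) *m w) = (inv w).+1.
Proof.
move=> hw h; have ow := weyl_orthog hw; set b0 := w^T *m alpha i in h *.
have e0 : w *m b0 = alpha i by rewrite orthogKV.
pose N := fun b => w *m b \notin Pos.
have hI : count (predI (pred1 b0) N) Pos = 0%N.
  rewrite (eq_in_count (a2 := pred0)) ?count_pred0 // => b _ /=.
  by apply/negbTE/negP => /andP[/eqP->]; rewrite /N e0 alpha_pos.
have := count_predUI (pred1 b0) N Pos.
rewrite hI addn0 count_uniq_mem ?pos_uniq // h add1n => <-.
apply: eq_in_count => b hb /=; rewrite -mulmxA /N.
have hwb : w *m b \in Phi by apply: weyl_root (pos_root hb).
have [->|nb] := eqVneq b b0.
  by rewrite e0 refl_self ?alpha_neq0 //= posN ?alpha_pos.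
rewrite /=; case: (boolP (w *m b \in Pos)) => hp.
  rewrite (simple_refl_pos hp) //.
  by apply: contraNneq nb => e; rewrite /b0 -e orthogK.
rewrite -negE; last by apply: (rs_refl hPhi) => //; exact: (rb_mem hbase).
rewrite -mulmxN simple_refl_pos ?negE //.
apply/eqP => e; have : - b = b0 by rewrite /b0 -e mulmxN orthogK.
by move=> e'; have := posN hb; rewrite e' h.
Qed.

Lemma inv_word_le s : (inv (wp s) <= size s)%N.
Proof.
elim: s => [|i s IH].
  rewrite /inv (eq_in_count (a2 := pred0)) ?count_pred0 // => b hb /=.
  by rewrite word_nil mul1mx hb.
rewrite word_cons; case: (boolP ((wp s)^T *m alpha i \in Pos)) => h.
  by rewrite inv_simple //=; apply: weyl_word.
have h' : (refl (alpha i) *m wp s)^T *m alpha i \in Pos.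
  rewrite trmx_mul trmx_refl -mulmxA refl_self ?alpha_neq0 // mulmxN negE //.
  by apply: weyl_rootT (weyl_word s) _; exact: (rb_mem hbase).
have := inv_simple (weylM (weyl_simple i) (weyl_word s)) h'.
rewrite simpleMK => e; apply: leq_trans (leqnSn _).
by apply: leq_trans IH; rewrite e.
Qed.

Lemma inv_word_ex w : weyl w -> exists2 s, wp s = w & size s = inv w.
Proof.
move=> /weylP[s <-]; elim: s => [|i s [t ht hs]].
  by exists [::] => //; apply/esym/eqP; rewrite -leqn0; apply: inv_word_le.
rewrite word_cons -ht; case: (boolP ((wp t)^T *m alpha i \in Pos)) => h.
  by exists (i :: t); rewrite ?word_cons ?inv_simple //= ?hs ?ht //; apply: weyl_word.
have [t' ht' hs'] := exchange (alpha_pos i) h.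
exists t'; rewrite // -ht'; apply/eqP; rewrite eqn_leq inv_word_le andbT -ltnS -hs' hs -ht.
have -> : wp t = refl (alpha i) *m wp t' by rewrite ht' simpleMK.
case: (boolP ((wp t')^T *m alpha i \in Pos)) => h'.
  by rewrite inv_simple //; apply: weyl_word.
move: h'; rewrite ht' trmx_mul trmx_refl -mulmxA refl_self ?alpha_neq0 // mulmxN.
rewrite negE ?h //.
by apply: weyl_rootT (weyl_word t) _; exact: (rb_mem hbase).
Qed.

Lemma lenE w : weyl w -> len w = inv w.
Proof.
move=> hw; rewrite /len; case: xgetP => [k _ [[s <- <-] hmin]|].
  have [t ht ts] := inv_word_ex (weyl_word s).
  by apply/eqP; rewrite eqn_leq inv_word_le -ts hmin.
move/(_ (inv w)); case; split; first by have [s h1 h2] := inv_word_ex hw; exists s.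
by move=> s <-; apply: inv_word_le.
Qed.

Lemma reduced_ex w : weyl w -> exists s, reduced_expr alpha w s.
Proof. by move=> hw; have [s h1 h2] := inv_word_ex hw; exists s; split; rewrite ?lenE. Qed.

Lemma len_word_le s : (len (wp s) <= size s)%N.
Proof. by rewrite lenE ?inv_word_le //; apply: weyl_word. Qed.

Lemma lenM_le v w : weyl v -> weyl w -> (len (v *m w) <= len v + len w)%N.
Proof.
move=> /reduced_ex[s [<- <-]] /reduced_ex[t [<- <-]].
by rewrite -word_cat -size_cat len_word_le.
Qed.

Lemma len1 : len 1%:M = 0%N.
Proof. by apply/eqP; rewrite -leqn0 -word_nil; apply: len_word_le. Qed.

Lemma len_simple_up i w : weyl w -> w^T *m alpha i \in Pos ->
  len (refl (alpha i) *m w) = (len w).+1.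
Proof.
by move=> hw h; rewrite !lenE ?inv_simple //; apply: weylM => //; apply: weyl_simple.
Qed.

Lemma simple_trN i w : (refl (alpha i) *m w)^T *m alpha i = - (w^T *m alpha i).
Proof.
by rewrite trmx_mul trmx_refl -mulmxA refl_self ?alpha_neq0 // mulmxN.
Qed.

Lemma len_simple_down i w : weyl w -> w^T *m alpha i \notin Pos ->
  len w = (len (refl (alpha i) *m w)).+1.
Proof.
move=> hw h; have hs := weylM (weyl_simple i) hw.
rewrite -{1}(simpleMK i w) len_simple_up // simple_trN negE //.
by apply: weyl_rootT hw _; exact: (rb_mem hbase).
Qed.

(** * Lengths of reflections *)

Lemma nonneg0 : nonneg_comb alpha 0.
Proof. by exists (fun=> 0%N); rewrite big1 // => i _; rewrite scale0r. Qed.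

Lemma nonnegD (x y : 'cV[R]_n) : nonneg_comb alpha x -> nonneg_comb alpha y ->
  nonneg_comb alpha (x + y).
Proof.
move=> [c ->] [d ->]; exists (fun i => (c i + d i)%N).
by rewrite -big_split; apply: eq_bigr => i _; rewrite natrD scalerDl.
Qed.

Lemma nonnegM (k : nat) (x : 'cV[R]_n) : nonneg_comb alpha x -> nonneg_comb alpha (x *+ k).
Proof.
move=> h; elim: k => [|k IH]; first by rewrite mulr0n; apply: nonneg0.
by rewrite mulrS; apply: nonnegD.
Qed.

Lemma all_neg w : weyl w -> (forall i, w *m alpha i \notin Pos) ->
  forall b, b \in Pos -> w *m b \notin Pos.
Proof.
move=> hw hneg b hb; have /posP[_ [c hc]] := hb.
rewrite -negE; last exact: weyl_root (pos_root hb).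
apply/posP; split; first by apply/rootN; exact: weyl_root (pos_root hb).
rewrite hc mulmx_sumr -sumrN.
elim/big_rec: _ => [|i x _ hx]; first exact: nonneg0.
apply: nonnegD hx; rewrite -scalemxAr -scalerN scaler_nat; apply: nonnegM.
have := hneg i; rewrite -negE; first by case/posP.
by apply: weyl_root => //; exact: (rb_mem hbase).
Qed.

Variable w0 : 'M[R]_n.
Hypothesis hw0 : longest alpha w0.

Lemma w0_weyl : weyl w0. Proof. by case: hw0. Qed.

Lemma w0_neg b : b \in Pos -> w0 *m b \notin Pos.
Proof.
have h i : w0^T *m alpha i \notin Pos.
  apply/negP => hi; have := hw0.2 _ (weylM (weyl_simple i) w0_weyl).
  by rewrite len_simple_up ?ltnn //; exact: w0_weyl.
move=> hb; apply/negP => h1.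
have := all_neg (weyl_tr w0_weyl) h h1.
by rewrite orthogK ?hb //; exact: weyl_orthog w0_weyl.
Qed.

(** The same induction as for the exchange condition: since w0 makes every positive
   root negative, each of them is met as a simple root along a word of w0. *)
Lemma neg_conj b s : b \in Pos -> (wp s)^T *m b \notin Pos ->
  exists t i, b = wp t *m alpha i.
Proof.
elim: s b => [|i s IH] b hb; first by rewrite word_nil trmx1 mul1mx hb.
rewrite word_cons trmx_mul trmx_refl -mulmxA => h.
have [->|bi] := eqVneq b (alpha i).
  by exists [::], i; rewrite word_nil mul1mx.
have [t [j ht]] := IH _ (simple_refl_pos hb bi) h.
by exists (i :: t), j; rewrite word_cons -mulmxA -ht simpleMK.
Qed.

Lemma root_conj a : a \in Phi -> exists t i, a = wp t *m alpha i.
Proof.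
have hpos b : b \in Pos -> exists t i, b = wp t *m alpha i.
  move=> hb; have /weylP[s hs] := w0_weyl.
  by apply: (neg_conj (s := rev s)) => //; rewrite word_rev trmxK hs w0_neg.
move=> ha; case: (boolP (a \in Pos)) => [/hpos//|]; rewrite -negE //.
move=> /hpos[t [i e]]; exists (t ++ [:: i]), i.
rewrite word_cat word_cons word_nil mulmx1 -mulmxA refl_self ?alpha_neq0 //.
by rewrite mulmxN -e opprK.
Qed.

Lemma weyl_refl g : g \in Phi -> weyl (refl g).
Proof.
move=> /root_conj[t [i ->]]; have ot := word_orthog t.
rewrite -[refl _]mulmx1 -(orthog_trK ot) mulmxA refl_orthog //.
by apply: weylM; [apply: weylM; [exact: weyl_word|exact: weyl_simple]|
  apply/weyl_tr; exact: weyl_word].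
Qed.

Lemma len_refl_lt w g : weyl w -> g \in Pos -> w *m g \notin Pos ->
  (len (w *m refl g) < len w)%N.
Proof.
move=> hw hg h; have ow := weyl_orthog hw; have [s [hs hl]] := reduced_ex hw.
have hb : - (w *m g) \in Pos by rewrite negE //; apply: weyl_root (pos_root hg).
have h' : (wp s)^T *m - (w *m g) \notin Pos by rewrite hs mulmxN orthogK // posN.
have [t ht ts] := exchange hb h'.
rewrite -hl ts ltnS -refl_orthog // -[refl (w *m g)]reflN.
by rewrite -[X in _ *m X]hs -ht len_word_le.
Qed.

Lemma len_refl_gt w g : weyl w -> g \in Pos -> w *m g \in Pos ->
  (len w < len (w *m refl g))%N.
Proof.
move=> hw hg h; have hr := weylM hw (weyl_refl (pos_root hg)).
have := len_refl_lt hr hg; rewrite -mulmxA refl_self ?pos_neq0 // mulmxN posN //.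
by rewrite -mulmxA reflK ?pos_neq0 // mulmx1; apply.
Qed.

Notation rho := (rho alpha Phi).

Lemma rhoE (x : 'cV[R]_n) : 2 * dot rho x = \sum_(b <- Pos) dot b x.
Proof. by rewrite /Defs.rho dotZl mulrA mulfV ?pnatr_eq0 // mul1r dot_suml. Qed.

(** The positive roots that a reflection keeps positive are permuted by it with
   opposite pairings against its coroot, so only the inversions contribute to the
   height; each contributes a positive integer, and the root itself contributes 2. *)
Lemma len_refl_height g : g \in Pos ->
  (len (refl g)).+1%:R <= 2 * dot rho (coroot g).
Proof.
move=> hg; have g0 := pos_neq0 hg; have gP := pos_root hg.
rewrite rhoE (bigID (fun b => refl g *m b \in Pos)) /=.
have hinv b : dot (refl g *m b) (coroot g) = - dot b (coroot g).
  rewrite dot_mulmx trmx_refl (_ : refl g *m coroot g = - coroot g) ?dotNr //.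
  by rewrite {2}/coroot -scalemxAr refl_self // scalerN.
have reflV b : refl g *m (refl g *m b) = b by rewrite mulmxA reflK // mul1mx.
rewrite -big_filter (sum_involution (f := mulmx (refl g))) //; first last.
- by move=> b; rewrite !mem_filter reflV => /andP[-> ->].
- exact: filter_uniq pos_uniq.
rewrite add0r lenE; last exact: weyl_refl.
rewrite /inv.
rewrite -sum1_count -addn1 natrD natr_sum.
have hone : \sum_(b <- Pos | refl g *m b \notin Pos) (b == g)%:R = 1%:R :> R.
  rewrite big_mkcond /= (bigD1_seq g) ?pos_uniq //= eqxx refl_self // posN //=.
  rewrite big1 ?addr0 // => b /negbTE->; by case: ifP.
rewrite -[X in _ + X]hone -big_split /= big_seq_cond [leRHS]big_seq_cond.
apply: ler_sum => b /andP[hb hbn].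
have [->|bg] := eqVneq b g; first by rewrite dot_coroot_self //=; lra.
rewrite addr0; have [k hk] := rs_int hPhi gP (pos_root hb).
rewrite hk; case: (ltP 0 k) => [k0|k0]; first by rewrite (ler_int _ 1) -gtz0_ge1.
case/negP: hbn; apply/posP; split; first exact: (rs_refl hPhi gP (pos_root hb)).
rewrite reflE hk; case: k k0 {hk} => [[|k]|k] // _.
  by rewrite scale0r subr0; case/posP: hb.
rewrite NegzE mulrNz scaleNr opprK -pmulrn scaler_nat.
by apply: nonnegD; [case/posP: hb|apply: nonnegM; case/posP: hg].
Qed.

Lemma rho_coroot_gt0 g : g \in Pos -> 0 < dot rho (coroot g).
Proof.
move=> hg; have := len_refl_height hg.
have : (0:R) < (len (refl g)).+1%:R by rewrite ltr0n.
lra.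
Qed.

Lemma rho_gt0 g : g \in Pos -> 0 < dot rho g.
Proof. by move=> hg; rewrite -dot_coroot_gt0 ?rho_coroot_gt0 // pos_neq0. Qed.

Lemma len_refl_lower w g : weyl w -> g \in Pos ->
  (len w)%:R + 1 <= (len (w *m refl g))%:R + 2 * dot rho (coroot g).
Proof.
move=> hw hg; have hr := weyl_refl (pos_root hg).
have := lenM_le (weylM hw hr) hr.
rewrite -mulmxA reflK ?pos_neq0 // mulmx1 -(ler_nat R) natrD => h1.
by have := len_refl_height hg; rewrite -addn1 natrD; lra.
Qed.

(** Positivity of the affine root b + c delta.  By apos_up and apos_down, it decides
   whether the affine reflection raises the semi-infinite length. *)
Definition apos (b : 'cV[R]_n) (c : int) : bool :=
  (0 < c) || ((c == 0) && (b \in Pos)).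

Lemma aposN b c : b \in Phi -> apos (- b) (- c) = ~~ apos b c.
Proof.
move=> hb; rewrite /apos oppr_gt0 oppr_eq0 negE //.
by case: (ltgtP c 0).
Qed.

Lemma apos_up w g c : weyl w -> g \in Pos -> apos (w *m g) c ->
  (len w)%:R < (len (w *m refl g))%:R + 2 * c%:~R * dot rho (coroot g).
Proof.
move=> hw hg /orP[c0|/andP[/eqP-> h]]; last first.
  by rewrite mulr0 mul0r addr0 ltr_nat len_refl_gt.
have := len_refl_lower hw hg; have := rho_coroot_gt0 hg => h1 h2.
have c1 : 1 <= c%:~R :> R by rewrite (ler_int _ 1) -gtz0_ge1.
have : dot rho (coroot g) <= c%:~R * dot rho (coroot g) by rewrite ler_peMl // ltW.
rewrite -mulrA; lra.
Qed.

Lemma apos_down w g c : weyl w -> g \in Pos -> ~~ apos (w *m g) c ->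
  (len (w *m refl g))%:R + 2 * c%:~R * dot rho (coroot g) < (len w)%:R.
Proof.
move=> hw hg; have hr := weylM hw (weyl_refl (pos_root hg)).
rewrite -aposN; last exact: weyl_root (pos_root hg).
have <- : w *m refl g *m g = - (w *m g).
  by rewrite -mulmxA refl_self ?pos_neq0 // mulmxN.
move=> /(apos_up hr hg); rewrite -mulmxA reflK ?pos_neq0 // mulmx1 mulrNz.
lra.
Qed.

(** * The roots of a reduced word *)

Notation roots := (word_roots alpha).
Notation reduced s := (len (wp s) = size s).

Lemma reduced_cons i s : reduced (i :: s) ->
  reduced s /\ (wp s)^T *m alpha i \in Pos.
Proof.
rewrite word_cons => h; have hs := weyl_word s.
case: (boolP ((wp s)^T *m alpha i \in Pos)) => hp.
  by move: h; rewrite len_simple_up // => -[].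
have := len_simple_down hs hp; rewrite h => e.
by have := len_word_le s; rewrite e /= ltnNge leqnSn.
Qed.

Lemma reduced_catr s t : reduced (s ++ t) -> reduced t.
Proof. by elim: s => [|i s IH] //= /reduced_cons[/IH]. Qed.

Lemma roots_cons i s : roots (i :: s) = (wp s)^T *m alpha i :: roots s.
Proof. by rewrite /= word_rev. Qed.

Lemma size_roots s : size (roots s) = size s.
Proof. by elim: s => //= i s ->. Qed.

Lemma drop_roots s t : drop (size s) (roots (s ++ t)) = roots t.
Proof. by elim: s => [|i s IH]; rewrite ?drop0. Qed.

Lemma roots_pos s : reduced s -> {subset roots s <= Pos}.
Proof.
elim: s => [|i s IH] // /reduced_cons[hs hi] b; rewrite roots_cons in_cons.
by case/orP => [/eqP->|/IH]; [|apply].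
Qed.

Lemma mem_roots s b : reduced s -> b \in Pos ->
  (b \in roots s) = (wp s *m b \notin Pos).
Proof.
move=> + hb; elim: s => [|i s IH]; first by rewrite word_nil mul1mx hb.
move=> /reduced_cons[hs hi]; rewrite roots_cons in_cons IH // word_cons -mulmxA.
have os := word_orthog s.
have hsb : wp s *m b \in Phi by apply: weyl_root (weyl_word s) (pos_root hb).
have [e|ne] := eqVneq b ((wp s)^T *m alpha i).
  by rewrite e orthogKV // refl_self ?alpha_neq0 // posN ?alpha_pos.
rewrite /=; case: (boolP (wp s *m b \in Pos)) => hp.
  rewrite (simple_refl_pos hp) //; apply: contraNneq ne => <-.
  by rewrite orthogK.
rewrite -negE; last by apply: (rs_refl hPhi) => //; exact: (rb_mem hbase).
rewrite -mulmxN simple_refl_pos ?negE //.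
apply/eqP => e; have e' : - b = (wp s)^T *m alpha i by rewrite -e mulmxN orthogK.
by have := posN hb; rewrite e' hi.
Qed.

Lemma roots_uniq s : reduced s -> uniq (roots s).
Proof.
elim: s => [|i s IH] // /reduced_cons[hs hi]; rewrite roots_cons cons_uniq IH //.
by rewrite andbT mem_roots // orthogKV ?alpha_pos //; apply: word_orthog.
Qed.

(** * The affine node *)

Lemma seq_argmax (T : eqType) (f : T -> R) (r : seq T) :
  r != [::] -> exists2 z : T, z \in r & forall z' : T, z' \in r -> f z' <= f z.
Proof.
elim: r => [|z r IH] // _; have [->|r0] := eqVneq r [::].
  by exists z; rewrite ?mem_head // => z'; rewrite inE => /eqP->.
have [z1 hz1 hmax] := IH r0; case: (leP (f z) (f z1)) => h.
  exists z1; first by rewrite in_cons hz1 orbT.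
  by move=> z'; rewrite in_cons => /orP[/eqP->|/hmax].
exists z; first exact: mem_head.
move=> z'; rewrite in_cons => /orP[/eqP->//|/hmax h'].
exact: le_trans h' (ltW h).
Qed.

Lemma simple_obtuse i j : i != j -> dot (alpha i) (alpha j) <= 0.
Proof.
move=> ij; rewrite leNgt; apply/negP => h.
have hne : alpha i != alpha j.
  apply/eqP => e.
  have := @alpha_free (fun k => (k == i)%:R - (k == j)%:R).
  rewrite (eq_bigr (fun k => (k == i)%:R *: alpha k - (k == j)%:R *: alpha k)).
    rewrite sumrB (bigD1 i) //= eqxx big1 => [|k /negbTE->]; last by rewrite scale0r.
    rewrite (bigD1 j) //= eqxx big1 => [|k /negbTE->]; last by rewrite scale0r.
    rewrite !scale1r e addr0 subrr => /(_ erefl i) /eqP.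
    by rewrite eqxx (negbTE ij) subr0 oner_eq0.
  by move=> k _; rewrite scalerBl.
have /posP[_ [d]] := simple_refl_pos (alpha_pos i) hne.
rewrite reflE => hd.
have e : \sum_k ((d k)%:R - (k == i)%:R + dot (alpha i) (coroot (alpha j)) * (k == j)%:R)
    *: alpha k = 0.
  rewrite (eq_bigr (fun k => (d k)%:R *: alpha k - (k == i)%:R *: alpha k +
    (dot (alpha i) (coroot (alpha j)) * (k == j)%:R) *: alpha k)); last first.
    by move=> k _; rewrite scalerDl scalerBl.
  rewrite big_split sumrB /= -hd.
  rewrite (bigD1 i) //= eqxx big1 => [|k /negbTE->]; last by rewrite scale0r.
  rewrite (bigD1 j) //= eqxx big1 => [|k /negbTE->]; last by rewrite mulr0 scale0r.
  by rewrite scale1r mulr1 !addr0 addrAC subrK subrr.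
have := alpha_free e j; rewrite eqxx mulr1 eq_sym (negbTE ij) subr0.
have h1 : 0 < dot (alpha i) (coroot (alpha j)) by rewrite dot_coroot_gt0 ?alpha_neq0.
have h2 : 0 <= (d j)%:R :> R by rewrite ler0n.
by move=> h3; lra.
Qed.

Definition in_span (J : pred 'I_n) a :=
  exists2 d : 'I_n -> R, a = \sum_i d i *: alpha i & forall i, ~~ J i -> d i = 0.

Lemma in_span_simple (J : pred 'I_n) i : in_span J (alpha i) <-> J i.
Proof.
have e0 : alpha i = \sum_k (k == i)%:R *: alpha k.
  rewrite (bigD1 i) //= eqxx scale1r big1 ?addr0 // => k /negbTE->.
  by rewrite scale0r.
split=> [[d hd hJ]|Ji]; last first.
  exists (fun k => (k == i)%:R) => // k; apply: contraNeq.
  by rewrite pnatr_eq0 eqb0 negbK => /eqP->.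
apply: contraT => nJ.
have e : \sum_k ((k == i)%:R - d k) *: alpha k = 0.
  rewrite (eq_bigr (fun k => (k == i)%:R *: alpha k - d k *: alpha k)).
    by rewrite sumrB -hd -e0 subrr.
  by move=> k _; rewrite scalerBl.
have := alpha_free e i; rewrite eqxx hJ // subr0 => /eqP.
by rewrite oner_eq0.
Qed.

Definition split_simple (J : pred 'I_n) :=
  forall i j, J i -> ~~ J j -> dot (alpha i) (alpha j) = 0.

Lemma in_span_orth (J : pred 'I_n) a b : split_simple J ->
  in_span J a -> in_span (predC J) b -> dot a b = 0.
Proof.
move=> hJ [c -> hc] [d -> hd]; rewrite dot_suml big1 // => i _.
rewrite dot_sumr big1 // => j _; rewrite dotZl dotZr.
case: (boolP (J i)) => Ji; last by rewrite hc // mul0r.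
case: (boolP (J j)) => Jj; last by rewrite hJ // !mulr0.
by rewrite hd ?mul0r ?mulr0 //= negbK.
Qed.

Lemma in_span_refl (J : pred 'I_n) a j : split_simple J ->
  in_span J a -> in_span J (refl (alpha j) *m a).
Proof.
move=> hJ ha; case: (boolP (J j)) => Jj.
  have [d -> hd] := ha; rewrite reflE; set k := dot _ _.
  exists (fun i => d i - k * (i == j)%:R).
    rewrite [RHS](eq_bigr (fun i => d i *: alpha i - (k * (i == j)%:R) *: alpha i)).
      rewrite sumrB; congr (_ - _); rewrite (bigD1 j) //= eqxx mulr1 big1 ?addr0 //.
      by move=> i /negbTE->; rewrite mulr0 scale0r.
    by move=> i _; rewrite scalerBl.
  move=> i nJ; rewrite hd // (_ : (i == j) = false) ?mulr0 ?subr0 //.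
  by apply: contraNF nJ => /eqP->.
rewrite reflE /coroot dotZr (in_span_orth hJ ha) ?mulr0 ?scale0r ?subr0 //.
by apply/in_span_simple.
Qed.

Hypothesis hirr : irreducible_root_system Phi.

(** Every root is conjugate to a simple one, so it stays in the span of J or in that
   of its complement, and irreducibility applies. *)
Lemma split_simple_trivial (J : pred 'I_n) i j : split_simple J -> J i -> J j.
Proof.
move=> hJ Ji; apply: contraT => nJj.
have hJc : split_simple (predC J).
  by move=> k l /= hk; rewrite negbK => hl; rewrite dotC hJ.
have hroot a : a \in Phi -> in_span J a \/ in_span (predC J) a.
  move=> /root_conj[t [k ->]]; elim: t => [|l t IH].
    rewrite word_nil mul1mx; case: (boolP (J k)) => hk; [left|right];
    exact/in_span_simple.
  by rewrite word_cons -mulmxA; case: IH => h; [left|right]; apply: in_span_refl.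
have [_ /(_ (fun a => `[< in_span J a >]))] := hirr; case.
- move=> a b ha hb /asboolP Pa /asboolPn Pb; apply: in_span_orth Pa _ => //.
  by case: (hroot b hb).
- move=> /(_ _ (rb_mem hbase j)) /asboolP /in_span_simple.
  by rewrite (negbTE nJj).
- by move=> /(_ _ (rb_mem hbase i)) /asboolPn; case; apply/in_span_simple.
Qed.

(** The properties of the highest root that make -th + delta behave like a simple
   root of the affine system. *)
Record affine_highest th (m : 'I_n -> nat) : Prop := AffineHighest {
  ah_pos : th \in Pos;
  ah_coef : th = \sum_i (m i)%:R *: alpha i;
  ah_full : forall i, (0 < m i)%N;
  ah_pair : forall b, b \in Pos -> b != th ->
    dot b (coroot th) = 0 \/ dot b (coroot th) = 1 /\ refl th *m b \notin Pos
}.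

(** Among the roots of maximal length, one of maximal height is dominant.  Dominance
   makes the simple roots outside of its support orthogonal to the support, which by
   irreducibility is everything; maximal length bounds the pairings by one. *)
Lemma affine_highest_ex : exists th m, affine_highest th m.
Proof.
have Phi0 : Phi != [::] by apply/eqP; case: hirr.
have [b1 hb1 max1] := seq_argmax (fun b => dot b b) Phi0.
pose L := [seq b <- Phi | dot b b == dot b1 b1].
have hL : b1 \in L by rewrite mem_filter eqxx.
have L0 : L != [::] by apply: contraTneq hL => ->.
have [th] := seq_argmax (fun b => dot rho b) L0.
rewrite mem_filter => /andP[/eqP hn thP] hmax.
have dom b : b \in Pos -> 0 <= dot th b.
  move=> hb; have b0 := pos_neq0 hb; have ob := orthog_refl b0.
  have : refl b *m th \in L.
    by rewrite mem_filter dot_orthog // hn eqxx (rs_refl hPhi) // pos_root.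
  move/hmax; rewrite reflE dotDr dotNr dotZr => h; have h1 := rho_gt0 hb.
  rewrite leNgt; apply/negP => h2.
  have h3 : 0 < - dot th (coroot b).
    by rewrite -dotNl dot_coroot_gt0 // dotNl oppr_gt0.
  have h4 := mulr_gt0 h3 h1; lra.
have th0 := root_neq0 thP.
have thPos : th \in Pos.
  apply: contraT; rewrite -negE // => /dom; rewrite dotNr oppr_ge0.
  by rewrite leNgt dot_gt0.
have /posP[_ [m hm]] := thPos.
have hfull i : (0 < m i)%N.
  have hJ : split_simple (fun i => 0 < m i)%N.
    move=> k l hk; rewrite -eqn0Ngt => /eqP hl.
    have hle j : (m j)%:R * dot (alpha j) (alpha l) <= 0.
      have [->|jl] := eqVneq j l; first by rewrite hl mul0r.
      by rewrite mulr_ge0_le0 ?ler0n ?simple_obtuse.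
    have := dom _ (alpha_pos l); rewrite hm dot_suml.
    rewrite (eq_bigr (fun j => (m j)%:R * dot (alpha j) (alpha l))); last first.
      by move=> j _; rewrite dotZl.
    rewrite (bigD1 k) //= => hs.
    have hs' : \sum_(j < n | j != k) (m j)%:R * dot (alpha j) (alpha l) <= 0.
      by apply: sumr_le0.
    have hk0 : (m k)%:R * dot (alpha k) (alpha l) == 0.
      by rewrite eq_le hle /=; lra.
    by move: hk0; rewrite mulf_eq0 pnatr_eq0 eqn0Ngt hk => /eqP.
  have [j hj] : exists j, (0 < m j)%N.
    apply/existsP; apply: contraNT th0 => /existsPn h; rewrite hm big1 // => j _.
    by have := h j; rewrite -eqn0Ngt => /eqP->; rewrite scale0r.
  exact: split_simple_trivial hJ hj.
exists th, m; split=> // b hb bth; have thn := dot_gt0 th0.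
have hbn : dot b b <= dot th th by rewrite hn; apply: max1; apply: pos_root.
have [k hk] := rs_int hPhi thP (pos_root hb); rewrite hk.
have ek : 2 * dot b th = k%:~R * dot th th.
  by rewrite -hk /coroot dotZr mulrAC mulfVK // gt_eqF.
have k0 : 0 <= k.
  rewrite -(ler_int R) -(pmulr_lge0 _ thn) -ek mulr_ge0 //.
  by rewrite dotC dom.
have k2 : k < 2.
  rewrite ltNge; apply/negP => k2; case/eqP: bth; apply/eqP.
  rewrite -subr_eq0 -dot_eq0 eq_le dot_ge0 andbT.
  rewrite dotDl !dotDr !dotNl !dotNr (dotC th b).
  have : 2 * dot th th <= k%:~R * dot th th.
    by rewrite ler_pM2r // (ler_int _ 2).
  by rewrite -ek; lra.
have [e|e] : k = 0 \/ k = 1 by lia.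
  by left; rewrite e.
right; rewrite e; split=> //; apply/negP => hp.
have := dom _ hp; move: (dot_gt0 (pos_neq0 hp)) ek.
rewrite reflE hk e !scale1r !(dotDl, dotDr, dotNl, dotNr) (dotC th b).
lra.
Qed.

(** * Left multiplication by the simple affine reflections *)

Variables (th : 'cV[R]_n) (m : 'I_n -> nat).
Hypothesis hth : affine_highest th m.
Implicit Types (o : option 'I_n) (c : int).

(** The simple affine root at node o is nr o + nc o delta; None is the affine node. *)
Definition nr o : 'cV[R]_n := if o is Some i then alpha i else - th.
Definition nc o : int := if o is Some _ then 0 else 1.

Notation sr o := (refl (nr o)).
Notation up o x := (x^T *m nr o \in Pos).

Lemma nr_root o : nr o \in Phi.
Proof.
case: o => [i|] /=; first exact: (rb_mem hbase).
by apply/rootN/pos_root; case: hth.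
Qed.

Lemma nr_neq0 o : nr o != 0.
Proof. exact: root_neq0 (nr_root o). Qed.

Lemma weyl_sr o : weyl (sr o).
Proof. exact: weyl_refl (nr_root o). Qed.

Lemma weyl_srM o x : weyl x -> weyl (sr o *m x).
Proof. by move=> hx; apply: weylM hx; apply: weyl_sr. Qed.

Lemma srK k o (x : 'M[R]_(n, k)) : sr o *m (sr o *m x) = x.
Proof. by rewrite mulmxA reflK ?nr_neq0 // mul1mx. Qed.

Lemma sr_tr o x : (sr o *m x)^T *m nr o = - (x^T *m nr o).
Proof. by rewrite trmx_mul trmx_refl -mulmxA refl_self ?nr_neq0 // mulmxN. Qed.

Lemma up_sr o x : weyl x -> up o (sr o *m x) = ~~ up o x.
Proof. by move=> hx; rewrite sr_tr negE //; apply: weyl_rootT (nr_root o). Qed.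

Lemma th_neq0 : th != 0.
Proof. by apply: pos_neq0; case: hth. Qed.

Lemma coef_sum0 : \sum_i (m i)%:R *: nr (Some i) + nr None = 0.
Proof. by rewrite /= -(ah_coef hth) subrr. Qed.

(** Expressing the change of sign by the pairing makes it summable over the positive
   roots; the two corrections account for the pairings 2 and -2 at th and - th. *)
Lemma th_sign a : a \in Phi ->
  (refl th *m a \notin Pos)%:R - (a \notin Pos)%:R
  = dot a (coroot th) - (a == th)%:R + (a == - th)%:R :> R.
Proof.
have thp := ah_pos hth; have t0 := th_neq0.
have key b : b \in Pos -> (refl th *m b \notin Pos)%:R
    = dot b (coroot th) - (b == th)%:R :> R.
  move=> hb; have [->|bt] := eqVneq b th.
    by rewrite refl_self // posN // dot_coroot_self //=; ring.
  rewrite subr0; case: (ah_pair hth hb bt) => [e|[-> ->] //].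
  by rewrite reflE e scale0r subr0 hb.
move=> ha; case: (boolP (a \in Pos)) => hp.
  rewrite key // (_ : (a == - th) = false) ?addr0 ?subr0 //=.
  by apply/negP => /eqP e; have := posN thp; rewrite -e hp.
have hN : - a \in Pos by rewrite negE.
have := key _ hN; rewrite mulmxN dotNl.
have hr : refl th *m a \in Phi by apply: (rs_refl hPhi) => //; exact: pos_root.
rewrite negE // negbK => h.
have -> : (a == th) = false.
  by apply/negP => /eqP e; rewrite e thp in hp.
rewrite -eqr_oppLR; move: h.
by case: (_ \in Pos) => /= h; lra.
Qed.

Lemma len_sum x : weyl x ->
  (len x)%:R = \sum_(b <- Pos) (x *m b \notin Pos)%:R :> R.
Proof.
move=> hx; rewrite lenE // /inv -sum1_count natr_sum big_mkcond.
by apply: eq_bigr => b _; case: (_ \in Pos).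
Qed.

(** At the affine node, this is the sum of th_sign over the images of the positive
   roots.  In terms of the semi-infinite length, a simple affine reflection changes
   it by exactly one. *)
Lemma len_sr o x : weyl x ->
  (len (sr o *m x))%:R = (len x)%:R + (if up o x then 1 else -1)
    - 2 * (nc o)%:~R * dot rho (coroot (x^T *m nr o)).
Proof.
move=> hx; have ox := weyl_orthog hx; case: o => [i|] /=.
  rewrite mulr0 mul0r subr0; case: ifP => h.
    by rewrite len_simple_up // -addn1 natrD.
  by rewrite (len_simple_down hx (negbT h)) -addn1 natrD; ring.
rewrite mulr1 reflN mulmxN corootN dotNr mulrN opprK.
have thp := ah_pos hth; have tP := pos_root thp.
rewrite rhoE coroot_orthog; last exact: orthog_tr.
have -> : (len (refl th *m x))%:R = (len x)%:R +
   \sum_(b <- Pos) ((refl th *m (x *m b) \notin Pos)%:R - (x *m b \notin Pos)%:R) :> R.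
  rewrite sumrB len_sum; last by apply: weylM hx; apply: weyl_refl.
  rewrite (len_sum hx) addrC subrK; apply: eq_bigr => b _.
  by rewrite mulmxA.
rewrite -addrA; congr (_ + _).
rewrite big_seq (eq_bigr (fun b => dot b (x^T *m coroot th)
   - (b == x^T *m th)%:R + (b == - (x^T *m th))%:R)); last first.
  move=> b hb; rewrite th_sign; last exact: weyl_root (pos_root hb).
  rewrite dot_mulmx; congr (_ - (nat_of_bool _)%:R + (nat_of_bool _)%:R).
    by apply/eqP/eqP => [<-|->]; rewrite ?orthogK ?orthogKV.
  apply/eqP/eqP => [e|->]; last by rewrite mulmxN orthogKV.
  by rewrite -mulmxN -e orthogK.
have hd a : \sum_(b <- Pos) (b == a)%:R = (a \in Pos)%:R :> R.
  case: (boolP (a \in Pos)) => ha.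
    rewrite (bigD1_seq a) ?pos_uniq //= eqxx big1 ?addr0 //.
    by move=> b /negbTE->.
  rewrite big_seq big1 // => b hb; case: eqP => // e.
  by rewrite -e hb in ha.
rewrite -big_seq big_split sumrB /= !hd negE; last exact: weyl_rootT.
by case: (_ \in Pos) => /=; ring.
Qed.

(** At the affine node, the only pairings with coroot th that exceed one are those of
   th and - th; a pairing equal to one makes the finite part change sign, which
   compensates the change of the delta part. *)
Lemma apos_sr o b c k : b \in Phi -> dot b (coroot (nr o)) = k%:~R ->
  apos b c -> (b, c) != (nr o, nc o) -> apos (sr o *m b) (c - nc o * k).
Proof.
case: o => [i|] hb /=.
  rewrite mul0r subr0 => _ /orP[c0|/andP[/eqP-> hp]]; first by rewrite /apos c0.
  rewrite xpair_eqE eqxx andbT => ne.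
  by rewrite /apos eqxx simple_refl_pos // orbT.
rewrite mul1r corootN dotNr reflN => hk hp.
have thp := ah_pos hth; have t0 := th_neq0.
have := th_sign hb; move: hp; rewrite /apos xpair_eqE.
have [e|bt] := eqVneq b th.
  have -> : k = - 2.
    by apply/(intr_inj (R := R)); rewrite -hk rmorphN e dot_coroot_self.
  rewrite e thp => h _ _; apply/orP; left; lia.
have [e|bt'] := eqVneq b (- th).
  have -> : k = 2.
    apply/(intr_inj (R := R)); rewrite -hk e dotNl dot_coroot_self // opprK.
    by [].
  rewrite e mulmxN refl_self // opprK thp (negbTE (posN thp)) andbF orbF /=.
  by move=> h1 _ h2; lia.
have ek : dot b (coroot th) = - k%:~R by rewrite -hk opprK.
rewrite ek subr0 addr0 /= => h + _.
have kE (d : int) : - k%:~R = d%:~R :> R -> k = - d.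
  by move=> e; apply/(intr_inj (R := R)); rewrite rmorphN /= -e opprK.
case: (b \in Pos) h => h; case: (refl th *m b \in Pos) => /= e.
- have := kE 0; rewrite -e subrr => /(_ erefl); lia.
- have := kE 1; rewrite -e subr0 => /(_ erefl); lia.
- have := kE (- 1); rewrite -e sub0r => /(_ erefl); lia.
- have := kE 0; rewrite -e subrr => /(_ erefl); lia.
Qed.

(** * Edges of the quantum Bruhat graph *)

(** An edge of the quantum Bruhat graph together with its weight c g^v: the
   Bruhat edges have c = 0 and the quantum ones c = 1, and lemma wedge_weight shows that no
   other c is possible.  The affine root behind the edge is x g + c delta. *)
Definition wedge g c x y : Prop :=
  [/\ g \in Pos, y = x *m refl g &
      (len y)%:R + 2 * c%:~R * dot rho (coroot g) = (len x)%:R + 1].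

Lemma wedge_weyl g c x y : weyl x -> wedge g c x y -> weyl y.
Proof. by move=> hx [hg -> _]; apply: weylM => //; apply/weyl_refl/pos_root. Qed.

Lemma wedge_apos g c x y : weyl x -> wedge g c x y -> apos (x *m g) c.
Proof.
move=> hx [hg -> e]; apply: contraT => /(apos_down hx hg); lra.
Qed.

Lemma wedge_weight g c x y : weyl x -> wedge g c x y -> c = 0 \/ c = 1.
Proof.
move=> hx h; have := wedge_apos hx h; case: h => hg -> e.
have := len_refl_lower hx hg; have := rho_coroot_gt0 hg => h0 h1 ha.
have c1 : c <= 1.
  rewrite -(ler_int R) -(ler_pM2r h0); lra.
by move: ha; rewrite /apos; lia.
Qed.

Lemma qbg_wedge x g y : weyl x ->
  qbg_edge alpha Phi x g y <-> exists c, wedge g c x y.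
Proof.
move=> hx; split=> [[hg e [h|h]]|[c h]].
- by exists 0; split=> //; rewrite h; ring.
- by exists 1; split=> //; rewrite h; ring.
have := wedge_weight hx h; case: h => hg e h hc; split=> //.
by case: hc h => -> h; [left|right]; lra.
Qed.

Lemma coroot_tr_refl o x g k : weyl x -> g \in Pos ->
  dot (x *m g) (coroot (nr o)) = k%:~R ->
  coroot ((x *m refl g)^T *m nr o) = coroot (x^T *m nr o) - k%:~R *: coroot g.
Proof.
move=> hx hg hk; have ox := orthog_tr (weyl_orthog hx).
rewrite trmx_mul trmx_refl -mulmxA.
rewrite coroot_orthog; last exact: orthog_refl (pos_neq0 hg).
rewrite reflE coroot_orthog // (_ : coroot g = (2 / dot g g) *: g) // dotZr scalerA.
by congr (_ - _ *: _); rewrite mulrC -hk dot_mulmx trmxK (dotC (coroot (nr o))).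
Qed.

(** The semi-infinite lengths of both ends change by the same amount. *)
Lemma wedge_flip o g c k x y : weyl x -> wedge g c x y -> up o x = up o y ->
  dot (x *m g) (coroot (nr o)) = k%:~R ->
  wedge g (c - nc o * k) (sr o *m x) (sr o *m y).
Proof.
move=> hx hw hup hk; have hy := wedge_weyl hx hw; have [hg e h] := hw.
split=> //; first by rewrite e mulmxA.
rewrite (len_sr o hx) (len_sr o hy) hup.
have ec := coroot_tr_refl hx hg hk; rewrite -e in ec.
have -> : (c - nc o * k)%:~R = c%:~R - (nc o)%:~R * k%:~R :> R.
  by rewrite rmorphB rmorphM.
rewrite ec dotDr dotNr (dotZr _ k%:~R); move: h.
case: ifP => _; lra.
Qed.

(** If the affine root of the edge is not the simple one at o, then its image under the
   simple reflection is still positive, so going from s_o x to s_o y raises the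
   semi-infinite length; but s_o x is one above x and s_o y one below y. *)
Lemma wedge_cross o g c x y : weyl x -> wedge g c x y -> up o x -> ~~ up o y ->
  x *m g = nr o /\ c = nc o.
Proof.
move=> hx hw hupx hupy; have hy := wedge_weyl hx hw; have [hg e h] := hw.
have xgP : x *m g \in Phi := weyl_root hx (pos_root hg).
have [k hk] := rs_int hPhi (nr_root o) xgP.
apply/pair_equal_spec/eqP; apply: contraT => ne.
have := apos_sr xgP hk (wedge_apos hx hw) ne; rewrite mulmxA.
move=> /(apos_up (weyl_srM o hx) hg); rewrite -mulmxA -e.
rewrite (len_sr o hx) (len_sr o hy) hupx (negbTE hupy).
have ec := coroot_tr_refl hx hg hk; rewrite -e in ec.
have -> : (c - nc o * k)%:~R = c%:~R - (nc o)%:~R * k%:~R :> R.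
  by rewrite rmorphB rmorphM.
rewrite ec dotDr dotNr (dotZr _ k%:~R); move: h.
lra.
Qed.

Lemma wedge_cross_eq o g c x y : weyl x -> wedge g c x y -> up o x -> ~~ up o y ->
  y = sr o *m x.
Proof.
move=> hx hw h1 h2; have [<- _] := wedge_cross hx hw h1 h2.
by case: hw => _ -> _; rewrite refl_orthog //; apply: weyl_orthog.
Qed.

Lemma wedge_up o x : weyl x -> up o x ->
  wedge (x^T *m nr o) (nc o) x (sr o *m x).
Proof.
move=> hx h; split=> //.
  by rewrite -refl_orthog ?orthogKV //; apply: weyl_orthog.
by rewrite (len_sr o hx) h; ring.
Qed.

Definition edge x g : bool := `[< exists c, wedge g c x (x *m refl g) >].

Lemma edgeP x g : reflect (exists c, wedge g c x (x *m refl g)) (edge x g).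
Proof. exact: asboolP. Qed.

Lemma edge_flip o x g : weyl x -> g \in Pos -> up o x = up o (x *m refl g) ->
  edge (sr o *m x) g = edge x g.
Proof.
have half z : weyl z -> g \in Pos -> up o z = up o (z *m refl g) ->
    edge z g -> edge (sr o *m z) g.
  move=> hz hg hup /edgeP[c hc]; apply/edgeP.
  have [k hk] := rs_int hPhi (nr_root o) (weyl_root hz (pos_root hg)).
  by exists (c - nc o * k); rewrite -mulmxA; apply: wedge_flip.
move=> hx hg hup; apply/idP/idP; last exact: half.
move=> h; rewrite -(srK o x); apply: half => //; first exact: weyl_srM.
rewrite -mulmxA !up_sr ?hup //.
by apply: weylM hx _; apply/weyl_refl/pos_root.
Qed.

Lemma edge_cross o x g : weyl x -> edge x g -> up o x ->
  ~~ up o (x *m refl g) -> x *m g = nr o.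
Proof. by move=> hx /edgeP[c /wedge_cross h] h1 h2; case: (h o). Qed.

Lemma edge_up o x : weyl x -> up o x -> edge x (x^T *m nr o).
Proof.
move=> hx h; apply/edgeP; exists (nc o).
by rewrite -refl_orthog ?orthogKV; [exact: wedge_up|exact: weyl_orthog|exact: weyl_orthog].
Qed.

Lemma edge_weyl x g : weyl x -> edge x g -> weyl (x *m refl g).
Proof. by move=> hx /edgeP[c /(wedge_weyl hx)]. Qed.

(** * Counting label-increasing paths *)

(** The sum of 2 ^ (length of p) over the paths p from x to u in the quantum
   Bruhat graph whose labels form a subsequence of L.  With these powers of 2, a sum
   equal to 2 ^ (distance) means that p is unique and shortest. *)
Fixpoint cnt (L : seq 'cV[R]_n) x u : nat :=
  if L is g :: L' then
    (cnt L' x u + (if edge x g then 2 * cnt L' (x *m refl g) u else 0))%N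
  else x == u.

(** This is the commutation of the operator prod_g (1 + 2 Q_g), where Q_g is the
   sum of the edges labelled g, with the left action of the simple affine
   reflections, cut at an arbitrary place of the word.  Which of the two forms it
   takes depends on whether the root x^-1 a_o belongs to the labels of s.  In the
   induction step, wp s sends the first label g to a simple root, so that reflecting
   by g moves x^-1 a_o within its class unless it is g itself; the edges labelled g
   at x and at s_o x are compared by edge_flip, edge_cross and edge_up. *)
Lemma cnt_sr s o x u : reduced s -> weyl x -> weyl u -> up o x -> up o u ->
  if wp s *m (x^T *m nr o) \in Pos then
    cnt (roots s) x (sr o *m u) = 0%N /\
    cnt (roots s) (sr o *m x) (sr o *m u) =
      (2 * cnt (roots s) (sr o *m x) u + cnt (roots s) x u)%N
  else
    cnt (roots s) x (sr o *m u) = (2 * cnt (roots s) x u)%N /\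
    cnt (roots s) (sr o *m x) (sr o *m u) = cnt (roots s) x u.
Proof.
move=> hs hx hu ux uu; have usu : up o (sr o *m u) = false by rewrite up_sr ?uu.
elim: s hs x hx ux => [_|i s IH hs] x hx ux.
  rewrite word_nil mul1mx ux /=.
  have -> : (x == sr o *m u) = false.
    by apply/negP => /eqP e; rewrite e usu in ux.
  have -> : (sr o *m x == u) = false.
    by apply/negP => /eqP e; move: uu; rewrite -e up_sr // ux.
  split=> //; rewrite muln0 add0n; congr nat_of_bool.
  by apply/eqP/eqP => [e|->] //; rewrite -(srK o x) e srK.
have [hs' hg] := reduced_cons hs; move: IH => /(_ hs') IH.
rewrite roots_cons; set g := (wp s)^T *m alpha i in hg *.
set y := x *m refl g; have hrg := weyl_refl (pos_root hg).
have hy : weyl y by apply: weylM.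
have hsx := weyl_srM o hx; have hsy := weyl_srM o hy.
have os := word_orthog s; have gE : wp s *m g = alpha i by rewrite orthogKV.
have ery : sr o *m x *m refl g = sr o *m y by rewrite -mulmxA.
have hyt : wp s *m (y^T *m nr o) = wp (i :: s) *m (x^T *m nr o).
  rewrite trmx_mul trmx_refl word_cons -[alpha i]gE -!mulmxA mulmxA [RHS]mulmxA.
  by rewrite refl_orthog.
have ux' := IH x hx ux.
(* The edge labelled g joins x and s_o x exactly when x^-1 a_o = g. *)
have [eg|neg] := eqVneq (x^T *m nr o) g.
  move: ux'; rewrite eg gE alpha_pos => -[e1 e2].
  rewrite word_cons -mulmxA gE refl_self ?alpha_neq0 // (negbTE (posN (alpha_pos i))).
  have yE : y = sr o *m x.
    by rewrite /y -eg -refl_orthog ?orthogKV //; apply: weyl_orthog.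
  have ex : edge x g by rewrite -eg; apply: edge_up.
  rewrite /= ex -/y ery yE srK e1 e2 muln0 if_same addn0 add0n.
  by clear; split; lia.
have hP : wp s *m (x^T *m nr o) \in Phi.
  by apply: weyl_root (weyl_word s) _; apply: pos_root.
have same : (wp (i :: s) *m (x^T *m nr o) \in Pos) = (wp s *m (x^T *m nr o) \in Pos).
  rewrite word_cons -mulmxA; case: (boolP (wp s *m _ \in Pos)) => hp.
    apply: simple_refl_pos => //; apply: contraNneq neg => e.
    by rewrite -(orthogK (x^T *m nr o) os) e.
  apply/negbTE; rewrite -negE; last first.
    by apply: (rs_refl hPhi) => //; exact: (rb_mem hbase).
  rewrite -mulmxN simple_refl_pos ?negE //.
  apply/eqP => e; have := posN hg.
  by rewrite /g -e mulmxN orthogK // opprK ux.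
rewrite same /= -/y ery; case: (boolP (up o y)) => uy.
  have eE : edge (sr o *m x) g = edge x g by apply: edge_flip; rewrite // ux uy.
  move: (IH y hy uy) ux'; rewrite hyt same eE.
  by case: ifP => _ [e1 e2] [e3 e4]; rewrite e1 e2 e3 e4; case: ifP => _; clear; lia.
(* The edge labelled g would cross the wall of a_o elsewhere than at s_o x. *)
have -> : edge x g = false.
  apply/negP => /edge_cross /(_ ux uy); case/(_ hx)/esym => e.
  by move: neg; rewrite e orthogK ?eqxx //; apply: weyl_orthog.
have usy : up o (sr o *m y) by rewrite up_sr.
move: (IH _ hsy usy) ux'; rewrite sr_tr mulmxN hyt negE ?same; last first.
  by rewrite -hyt; apply: weyl_root (weyl_word s) _; apply: weyl_rootT (nr_root o).
by case: (_ \in Pos) => /= -[e1 _] [e3 e4]; rewrite e1 e3 e4; case: ifP => _; clear; lia.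
Qed.

(** * The semi-infinite order *)

Implicit Types (X Y Z : affine R n) (xi : 'cV[R]_n).

Notation silen := (si_len alpha Phi).

(** The action of the simple affine reflections on the affine Weyl group. *)
Definition sra o X : affine R n :=
  (sr o *m X.1, X.2 + (nc o)%:~R *: coroot (X.1^T *m nr o)).

Lemma sraK o X : sra o (sra o X) = X.
Proof.
case: X => x xi; rewrite /sra /= srK sr_tr corootN scalerN.
by rewrite addrK.
Qed.

(** The edges of the semi-infinite order (lemma si_edgeP), labelled from the right: the
   reflection in beta on the left of x is the one in x^-1 beta on its right, and the
   finite part of x^-1 beta is, up to sign, the label in the quantum Bruhat graph. *)
Definition aedge X Y : Prop :=
  exists g c, wedge g c X.1 Y.1 /\ Y.2 = X.2 + c%:~R *: coroot g.

Lemma si_edgeP X Y : weyl X.1 -> si_edge alpha Phi X Y <-> aedge X Y.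
Proof.
case: X Y => [x xi] [y zeta] hx /=; have ox := weyl_orthog hx; split.
  case=> -[a k] hak [[ey ez] hl].
  have aP : a \in Phi by case: hak => /= -[] // /pos_root.
  rewrite /= orthog_inv // -scalemxAr -coroot_orthog in ez; last exact: orthog_tr.
  have xaP : x^T *m a \in Phi by apply: weyl_rootT.
  have ey' : y = x *m refl (x^T *m a) by rewrite -refl_orthog // orthogKV.
  rewrite /si_len /= in hl; case: (boolP (x^T *m a \in Pos)) => hp.
    exists (x^T *m a), (Posz k); rewrite ez addrC; split=> //; split=> //.
    by move: hl; rewrite ez dotDr dotZr; lra.
  exists (- (x^T *m a)), (- Posz k); split; last first.
    by rewrite ez /= corootN rmorphN scaleNr scalerN opprK addrC.
  split; rewrite ?negE ?reflN //; move: hl.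
  by rewrite ez dotDr dotZr corootN dotNr rmorphN /=; lra.
case=> g [c [hw /= ez]]; have hc := wedge_weight hx hw.
have ha := wedge_apos hx hw; case: hw => /= hg ey hl.
have xg : x *m g \in Phi := weyl_root hx (pos_root hg).
have eg : coroot g = x^T *m coroot (x *m g) by rewrite coroot_orthog // orthogK.
have main (k : nat) : c = k -> pos_af alpha Phi (x *m g, k) ->
    si_edge alpha Phi (x, xi) (y, zeta).
  move=> ck hpos; exists (x *m g, k) => //; split.
    rewrite /af_mul /refl_af /= refl_orthog // orthog_inv // ey ez ck.
    by rewrite -scalemxAr -eg addrC.
  by rewrite /si_len /= ez dotDr (dotZr _ c%:~R); lra.
case: hc => ec.
  apply: (main 0%N) => //; left; split=> //.
  by move: ha; rewrite /apos ec eqxx.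
by apply: (main 1%N) => //; right.
Qed.

Lemma aedge_weyl X Y : weyl X.1 -> aedge X Y -> weyl Y.1.
Proof. by move=> hx [g [c [/(wedge_weyl hx)]]]. Qed.

Lemma aedge_silen X Y : aedge X Y -> silen Y = silen X + 1.
Proof.
case=> g [c [[_ _ h] e]]; rewrite /si_len e dotDr (dotZr _ c%:~R); lra.
Qed.

Lemma aedge_flip o X Y : weyl X.1 -> aedge X Y -> up o X.1 = up o Y.1 ->
  aedge (sra o X) (sra o Y).
Proof.
move=> hx [g [c [hw e]]] hup; have [hg ey _] := hw.
have [k hk] := rs_int hPhi (nr_root o) (weyl_root hx (pos_root hg)).
exists g, (c - nc o * k); split; first exact: wedge_flip.
rewrite /= e ey (coroot_tr_refl hx hg hk) rmorphB rmorphM /=.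
rewrite scalerBr scalerBl -(scalerA _ k%:~R) -!addrA; congr (_ + _).
exact: addrCA.
Qed.

Lemma aedge_cross o X Y : weyl X.1 -> aedge X Y -> up o X.1 -> ~~ up o Y.1 ->
  Y = sra o X.
Proof.
case: X Y => [x xi] [y zeta] /= hx [g [c [/= hw e]]] h1 h2.
have ox := weyl_orthog hx.
have := wedge_cross_eq hx hw h1 h2; have [eg ec] := wedge_cross hx hw h1 h2.
by rewrite /sra /= => <-; rewrite e ec -eg orthogK.
Qed.

Lemma aedge_up o X : weyl X.1 -> up o X.1 -> aedge X (sra o X).
Proof.
move=> hx h; exists (X.1^T *m nr o), (nc o); split=> //.
exact: wedge_up.
Qed.

(** The semi-infinite order (lemma si_leP), presented so that inductions run along a
   path from its source. *)
Inductive ale : affine R n -> affine R n -> Prop :=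
| ale_refl X : ale X X
| ale_step X Y Z : aedge X Y -> ale Y Z -> ale X Z.

Lemma ale1 X Y : aedge X Y -> ale X Y.
Proof. by move=> h; apply: ale_step h (ale_refl _). Qed.

Lemma ale_trans X Y Z : ale X Y -> ale Y Z -> ale X Z.
Proof. by move=> h1 h2; elim: h1 h2 => // *; eapply ale_step; eauto. Qed.

Lemma ale_weyl X Y : weyl X.1 -> ale X Y -> weyl Y.1.
Proof. by move=> hx h; elim: h hx => // ? ? ? h _ IH /aedge_weyl /(_ h). Qed.

Lemma si_leP X Y : weyl X.1 -> si_le alpha Phi X Y <-> ale X Y.
Proof.
move=> hx; split=> [h|h].
  suff : weyl X.1 -> ale X Y /\ weyl Y.1 by case/(_ hx).
  elim: h => {hx} [{}X {}Y h|{}X|{}X {}Y Z _ IH1 _ IH2] hx.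
  - by move/(si_edgeP _ hx): h => h; split; [apply: ale1|apply: aedge_weyl h].
  - by split=> //; apply: ale_refl.
  - have [h1 h2] := IH1 hx; have [h3 h4] := IH2 h2; split=> //.
    exact: ale_trans h1 h3.
elim: h hx => {X Y} [X|X Y Z h _ IH] hx; first exact: rt_refl.
apply: rt_trans (IH (aedge_weyl hx h)); apply: rt_step.
exact/si_edgeP.
Qed.

(** The lifting property; the third part, for two elements on the lower side, is what
   makes the induction along a path work. *)
Lemma lifting o X Y : weyl X.1 -> ale X Y -> ~~ up o Y.1 ->
  (up o X.1 -> ale (sra o X) Y /\ ale X (sra o Y)) /\
  (~~ up o X.1 -> ale (sra o X) (sra o Y)).
Proof.
move=> hx h hY; elim: h hY hx => {X Y} [X|X X' Y h h' IH] hY hx.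
  by rewrite (negbTE hY); split=> // _; apply: ale_refl.
have hx' := aedge_weyl hx h; have [IH1 IH2] := IH hY hx'.
split=> hX; case: (boolP (up o X'.1)) => hX'.
- have [h1 h2] := IH1 hX'; split; last exact: ale_step h h2.
  by apply: ale_step h1; apply: aedge_flip => //; rewrite hX hX'.
- have e := aedge_cross hx h hX hX'; have := IH2 hX'.
  by rewrite {1}e sraK; split=> //; rewrite -e.
- have [_ h2] := IH1 hX'; apply: ale_step (ale_step h h2).
  rewrite -{2}(sraK o X); apply: aedge_up; first exact: weyl_srM.
  by rewrite up_sr.
apply: ale_step (IH2 hX'); apply: aedge_flip => //.
by rewrite (negbTE hX) (negbTE hX').
Qed.

Lemma ale_shift kap x xi y zeta :
  ale (x, xi) (y, zeta) -> ale (x, xi + kap) (y, zeta + kap).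
Proof.
have gen X Y : ale X Y -> ale (X.1, X.2 + kap) (Y.1, Y.2 + kap).
  elim=> [Z|Z1 Z2 Z3 [g [c [h e]]] _ IH]; first exact: ale_refl.
  apply: ale_step IH; exists g, c; split=> //=.
  by rewrite e addrAC.
exact: gen.
Qed.

Lemma ale_shiftE kap x xi y zeta :
  ale (x, xi + kap) (y, zeta) <-> ale (x, xi) (y, zeta - kap).
Proof.
split=> [/(ale_shift (- kap))|/(ale_shift kap)]; first by rewrite addrK.
by rewrite subrK.
Qed.

Lemma ale_silen X Y : ale X Y -> exists k : nat, silen Y = silen X + k%:R.
Proof.
elim=> [Z|Z1 Z2 Z3 /aedge_silen h _ [k IH]]; first by exists 0%N; rewrite addr0.
by exists k.+1; rewrite IH h -addn1 natrD; lra.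
Qed.

Lemma aedge_rho X Y : weyl X.1 -> aedge X Y ->
  dot rho X.2 <= dot rho Y.2.
Proof.
move=> hx [g [c [hw ->]]]; rewrite dotDr (dotZr _ c%:~R) lerDl.
have := wedge_weight hx hw; have [/rho_coroot_gt0 h _ _] := hw.
by case=> ->; rewrite ?mul0r // mul1r ltW.
Qed.

Lemma ale_rho X Y : weyl X.1 -> ale X Y -> dot rho X.2 <= dot rho Y.2.
Proof.
move=> hx h; elim: h hx => // Z1 Z2 Z3 h _ IH hx.
exact: le_trans (aedge_rho hx h) (IH (aedge_weyl hx h)).
Qed.

Lemma ale_qbg X Y : weyl X.1 -> ale X Y ->
  exists2 p, qbg_path alpha Phi X.1 p Y.1 & silen Y = silen X + (size p)%:R.
Proof.
move=> hx h; elim: h hx => [Z|Z1 Z2 Z3 h _ IH] hx; first by exists [::]; rewrite ?addr0.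
have [p hp hs] := IH (aedge_weyl hx h); have e := aedge_silen h.
case: h => g [c [hw _]]; exists (g :: p); last first.
  by rewrite hs e /= -(addn1 (size p)) natrD; lra.
by exists Z2.1 => //; apply/qbg_wedge => //; exists c.
Qed.

Lemma qbg_ale x p u xi : weyl x -> qbg_path alpha Phi x p u ->
  exists2 zeta, ale (x, xi) (u, zeta) &
    silen (u, zeta) = silen (x, xi) + (size p)%:R.
Proof.
elim: p x xi => [|g p IH] x xi hx /=.
  by move=> ->; exists xi; rewrite ?addr0 //; apply: ale_refl.
case=> y /(qbg_wedge g y hx)[c hw] /(IH _ (xi + c%:~R *: coroot g) (wedge_weyl hx hw)).
have ha : aedge (x, xi) (y, xi + c%:~R *: coroot g) by exists g, c.
case=> zeta h1 h2; exists zeta; first exact: ale_step ha h1.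
by rewrite h2 (aedge_silen ha) -(addn1 (size p)) natrD; lra.
Qed.

(** * The coroot lattice *)

Lemma lattice_add a b : coroot_lattice alpha a -> coroot_lattice alpha b ->
  coroot_lattice alpha (a + b).
Proof.
move=> [c ->] [d ->]; exists (fun i => c i + d i).
by rewrite -big_split; apply: eq_bigr => i _; rewrite rmorphD scalerDl.
Qed.

Lemma lattice_scale (k : int) a : coroot_lattice alpha a ->
  coroot_lattice alpha (k%:~R *: a).
Proof.
move=> [c ->]; exists (fun i => k * c i).
by rewrite scaler_sumr; apply: eq_bigr => i _; rewrite rmorphM scalerA.
Qed.

Lemma lattice_simple i : coroot_lattice alpha (coroot (alpha i)).
Proof.
exists (fun j => (j == i)%:R); rewrite (bigD1 i) //= eqxx scale1r big1 ?addr0 //.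
by move=> j /negbTE->; rewrite scale0r.
Qed.

Lemma lattice0 : coroot_lattice alpha 0.
Proof. by exists (fun=> 0); rewrite big1 // => i _; rewrite scale0r. Qed.

Lemma lattice_coroot a : a \in Phi -> coroot_lattice alpha (coroot a).
Proof.
move=> /root_conj[t [i ->]]; elim: t => [|j t IH].
  by rewrite word_nil mul1mx; apply: lattice_simple.
rewrite word_cons -mulmxA; set b := wp t *m alpha i in IH *.
have bP : b \in Phi by apply: weyl_root (weyl_word t) (rb_mem hbase i).
rewrite coroot_orthog; last exact: orthog_refl (alpha_neq0 j).
rewrite reflE -[coroot b]/((2 / dot b b) *: b) dotZl.
have [k hk] := rs_int hPhi bP (rb_mem hbase j).
have -> : (2 / dot b b * dot b (coroot (alpha j))) *: alpha j
   = k%:~R *: coroot (alpha j).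
  by rewrite /coroot dotZr -hk /coroot dotZr scalerA (dotC b); congr (_ *: _); ring.
by rewrite -scaleNr -rmorphN; apply: lattice_add IH (lattice_scale _ (lattice_simple j)).
Qed.

Lemma ale_lattice X Y : ale X Y ->
  coroot_lattice alpha X.2 -> coroot_lattice alpha Y.2.
Proof.
elim=> // Z1 Z2 Z3 [g [c [[hg _ _] e]]] _ IH h; apply: IH; rewrite e.
by apply: lattice_add h (lattice_scale _ (lattice_coroot (pos_root hg))).
Qed.

(** * Reaching the identity *)

Inductive reach x : 'M[R]_n -> Prop :=
| reach_refl : reach x x
| reach_step o y : reach x y -> up o y -> reach x (sr o *m y).

Lemma weyl_enum : exists2 W : seq 'M[R]_n, uniq W & forall x, (x \in W) <-> weyl x.
Proof.
pose ws := flatten [seq map (fun r : k.-tuple 'I_n => wp (val r)) (enum {: k.-tuple 'I_n})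
  | k <- iota 0 (len w0).+1].
exists (undup ws); first exact: undup_uniq.
move=> x; rewrite mem_undup; split.
  by case/flatten_mapP => k _ /mapP[r _ ->]; apply: weyl_word.
move=> hx; have [s [hs hl]] := reduced_ex hx.
apply/flatten_mapP; exists (len x).
  by rewrite mem_iota add0n ltnS; apply: hw0.2.
have hsz : size s == len x by apply/eqP.
by apply/mapP; exists (Tuple hsz); rewrite ?mem_enum.
Qed.

(** Averaging dot rho (y^-1 a_o) over the set reached: pairs y, s_o y cancel and
   an unpaired y contributes negatively, while some positive combination of the a_o
   vanishes.  Hence no y is unpaired, and the set reached is stable under W. *)
Lemma reach1 x : weyl x -> reach x 1%:M.
Proof.
move=> hx; have [W uW hW] := weyl_enum.
pose X := [seq y <- W | `[< reach x y >]].
have uX : uniq X by rewrite filter_uniq.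
have XP y : (y \in X) <-> (weyl y /\ reach x y).
  rewrite mem_filter; split=> [/andP[/asboolP h /hW]|[/hW h h']] //.
  by rewrite h andbT; apply/asboolP.
pose psi o y := dot rho (y^T *m nr o).
have psiN o y : psi o (sr o *m y) = - psi o y by rewrite /psi sr_tr dotNr.
pose S o := \sum_(y <- X) psi o y.
have SE o : S o = \sum_(y <- X | sr o *m y \notin X) psi o y.
  rewrite /S (bigID (fun y => sr o *m y \in X)) /= -big_filter.
  rewrite (sum_involution (f := fun y => sr o *m y)) ?add0r //.
  - by rewrite filter_uniq.
  - by move=> y; rewrite srK.
  - by move=> y; rewrite !mem_filter srK => /andP[-> ->].
have unpaired o y : y \in X -> sr o *m y \notin X -> psi o y < 0.
  move=> /XP[hy hr] hn; rewrite -oppr_gt0 -dotNr; apply: rho_gt0.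
  rewrite negE; last exact: weyl_rootT (nr_root o).
  apply: contra hn => hup; apply/XP; split; first exact: weyl_srM.
  exact: reach_step.
have Sle o : S o <= 0.
  rewrite SE big_seq_cond; apply: sumr_le0 => y /andP[h1 h2].
  exact/ltW/unpaired.
have Slt o y : y \in X -> sr o *m y \notin X -> S o < 0.
  move=> h1 h2; rewrite SE -big_filter (bigD1_seq y) ?filter_uniq //=; last first.
    by rewrite mem_filter h2.
  apply: (le_lt_trans (y := psi o y)); last exact: unpaired.
  rewrite gerDl big_seq_cond sumr_le0 // => z /andP[+ _].
  by rewrite mem_filter => /andP[h3 h4]; apply/ltW/unpaired.
have Stot : \sum_i (m i)%:R * S (Some i) + S None = 0.
  rewrite /S (eq_bigr (fun i => \sum_(y <- X) (m i)%:R * psi (Some i) y)).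
    rewrite exchange_big -big_split /= big1 // => y _.
    have := congr1 (fun v : 'cV[R]_n => dot rho (y^T *m v)) coef_sum0.
    rewrite mulmx0 dot0r mulmxDr dotDr mulmx_sumr dot_sumr => h; rewrite -[RHS]h.
    by congr (_ + _); apply: eq_bigr => i _; rewrite -scalemxAr dotZr.
  by move=> i _; rewrite mulr_sumr.
have stable i y : y \in X -> refl (alpha i) *m y \in X.
  move=> hy; apply: contraT => hn; have hlt := Slt (Some i) _ hy hn.
  have hm : 0 < (m i)%:R :> R by rewrite ltr0n; case: hth.
  have h1 : (m i)%:R * S (Some i) < 0 by rewrite pmulr_rlt0.
  have h2 : \sum_(j | j != i) (m j)%:R * S (Some j) <= 0.
    by apply: sumr_le0 => j _; rewrite mulr_ge0_le0 ?ler0n.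
  by have := Sle None; move: Stot; rewrite (bigD1 i) //=; lra.
have hX : x \in X by apply/XP; split=> //; apply: reach_refl.
have hw s : wp s \in X -> 1%:M \in X.
  elim: s => [|i s IH]; first by rewrite word_nil.
  by rewrite word_cons => /(stable i); rewrite simpleMK.
by have /weylP[s hs] := hx; move: (hw s); rewrite hs => /(_ hX) /XP[].
Qed.

(** All simple reflections are ascents of 1, so the two rules lead from (1, 1) to every
   (1, u); and reach1 leads from any (x, u) to some (1, u'). *)
Lemma pair_ind (G : 'M[R]_n -> 'M[R]_n -> Prop) :
  (forall o x u, weyl x -> weyl u -> up o x -> up o u ->
     G (sr o *m x) (sr o *m u) <-> G x u) ->
  (forall o x u, weyl x -> weyl u -> up o x -> ~~ up o u ->
     G (sr o *m x) u <-> G x u) ->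
  G 1%:M 1%:M -> forall x u, weyl x -> weyl u -> G x u.
Proof.
move=> h1 h2 G1.
have up1 i : up (Some i) 1%:M by rewrite trmx1 mul1mx alpha_pos.
have row1 i u : weyl u -> G 1%:M u -> G 1%:M (refl (alpha i) *m u).
  move=> hu hG; have hsu : weyl (refl (alpha i) *m u) := weyl_srM (Some i) hu.
  case: (boolP (up (Some i) u)) => hup.
    have hn : ~~ up (Some i) (refl (alpha i) *m u).
      by rewrite (up_sr (Some i) hu) negbK.
    apply/(h2 _ _ _ weyl1 hsu (up1 i) hn).
    exact/(h1 _ _ _ weyl1 hu (up1 i) hup).
  have hn : up (Some i) (refl (alpha i) *m u) by rewrite (up_sr (Some i) hu).
  apply/(h1 _ _ _ weyl1 hsu (up1 i) hn); rewrite (srK (Some i)).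
  exact/(h2 _ _ _ weyl1 hu (up1 i) hup).
have G1u u : weyl u -> G 1%:M u.
  move=> /weylP[s <-]; elim: s => [|i s IH]; first by rewrite word_nil.
  by rewrite word_cons; apply: row1 => //; apply: weyl_word.
have back x y : weyl x -> reach x y ->
    weyl y /\ forall u, weyl u -> exists2 u', weyl u' & G y u' <-> G x u.
  move=> hx; elim=> [|o z _ [hz IH] hup].
    by split=> // u hu; exists u.
  split; first exact: weyl_srM.
  move=> u hu; have [u' hu' e] := IH u hu.
  case: (boolP (up o u')) => hup'.
    exists (sr o *m u'); first exact: weyl_srM.
    by rewrite -e; apply: h1.
  by exists u' => //; rewrite -e; apply: h2.
move=> x u hx hu; have [_ /(_ u hu)[u' hu' e]] := back _ _ hx (reach1 hx).
exact/e/G1u.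
Qed.

(** * Distances and weights of shortest paths *)

Variable rd : seq 'I_n.
Hypothesis hrd : reduced_expr alpha w0 rd.

Notation F := (cnt (roots rd)).

Lemma rd_reduced : reduced rd.
Proof. by case: hrd => <- <-. Qed.

Lemma F_up o x u : weyl x -> weyl u -> up o x -> up o u ->
  F x (sr o *m u) = (2 * F x u)%N /\ F (sr o *m x) (sr o *m u) = F x u.
Proof.
move=> hx hu ux uu; have := cnt_sr rd_reduced hx hu ux uu.
by case: hrd => -> _; rewrite (negbTE (w0_neg ux)).
Qed.

Lemma F_down o x u : weyl x -> weyl u -> up o x -> ~~ up o u ->
  F x u = (2 * F (sr o *m x) u)%N.
Proof.
move=> hx hu ux uu; have hsu := weyl_srM o hu.
have [] := F_up hx hsu ux _; first by rewrite up_sr.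
by rewrite srK => -> ->.
Qed.

Lemma ale_sra o X Y : weyl X.1 -> ale X Y -> up o X.1 -> up o Y.1 ->
  ale (sra o X) (sra o Y).
Proof.
move=> hX h uX uY; have hY := ale_weyl hX h.
have h' : ale X (sra o Y) := ale_trans h (ale1 (aedge_up hY uY)).
have [|+ _] := lifting (o := o) hX h'; first by rewrite up_sr // negbK.
by move=> /(_ uX)[].
Qed.

Lemma ale_sraE o X Y : weyl X.1 -> weyl Y.1 -> up o X.1 -> up o Y.1 ->
  ale (sra o X) (sra o Y) <-> ale X Y.
Proof.
move=> hX hY uX uY; split=> [h|h]; last exact: ale_sra.
have h' : ale X (sra o Y) := ale_trans (ale1 (aedge_up hX uX)) h.
have [|+ _] := lifting (o := o) hX h'; first by rewrite up_sr // negbK.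
by rewrite sraK => /(_ uX)[].
Qed.

Lemma ale_sralE o X Y : weyl X.1 -> up o X.1 -> ~~ up o Y.1 ->
  ale (sra o X) Y <-> ale X Y.
Proof.
move=> hX uX uY; split=> [|h]; first exact: ale_trans (ale1 (aedge_up hX uX)).
by have [+ _] := lifting hX h uY; case/(_ uX).
Qed.

(** The weights of closed paths at the identity: the nonnegative integral combinations
   of simple coroots.  Defined by paths, the set is carried along by the moves of
   pair_ind, and S0_rho and S0_eq0 express its positivity. *)
Definition S0 xi : Prop := ale (1%:M, 0) (1%:M, xi).

Lemma S0_0 : S0 0. Proof. exact: ale_refl. Qed.

Lemma silen1 xi : silen (1%:M, xi) = 2 * dot rho xi.
Proof. by rewrite /si_len len1 add0r. Qed.

Lemma S0_rho xi : S0 xi -> 0 <= dot rho xi.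
Proof. by move/(@ale_rho (1%:M, 0) (1%:M, xi) weyl1); rewrite /= dot0r. Qed.

Lemma ale_silen_eq X Y : ale X Y -> silen Y <= silen X -> X = Y.
Proof.
case=> // {}X Z {}Y /aedge_silen h /ale_silen[k ->]; rewrite h.
by move=> hle; have hk := ler0n R k; exfalso; lra.
Qed.

Lemma S0_eq0 xi : S0 xi -> dot rho xi <= 0 -> xi = 0.
Proof.
move=> h hr; have e : (1%:M, 0) = (1%:M, xi) :> affine R n.
  by apply: (ale_silen_eq h); rewrite !silen1 dot0r; lra.
by case: e.
Qed.

Definition shiftat o x : 'cV[R]_n := (nc o)%:~R *: coroot (x^T *m nr o).

Lemma silen_sra o X : weyl X.1 -> up o X.1 -> silen (sra o X) = silen X + 1.
Proof. by move=> hX uX; apply/aedge_silen/aedge_up. Qed.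

(** The weights of the paths from x to u form a translate of S0; the count of
   increasing paths depends on x and u only through the length of a path of the
   minimal weight, up to the constant K. *)
Definition good (K : nat) x u : Prop := exists xi0,
  (forall xi, ale (x, 0) (u, xi) <-> S0 (xi - xi0)) /\
  (forall N : nat, N%:R = silen (u, xi0) - silen (x, 0) -> F x u = (K * 2 ^ N)%N).

Lemma ale_min x u xi0 : (forall xi, ale (x, 0) (u, xi) <-> S0 (xi - xi0)) ->
  ale (x, 0) (u, xi0).
Proof. by move=> h; apply/h; rewrite subrr; apply: S0_0. Qed.

(** Both rules of pair_ind follow from lifting, which compares the reachable weights, and
   from cnt_sr, which compares the counts. *)
Lemma good_all x u : weyl x -> weyl u -> good (F 1%:M 1%:M) x u.
Proof.
move: x u; apply: pair_ind.
- move=> o x u hx hu ux uu; have [_ eF] := F_up hx hu ux uu.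
  have e xi : ale (sr o *m x, 0) (sr o *m u, xi + (shiftat o u - shiftat o x))
     <-> ale (x, 0) (u, xi).
    by rewrite addrA -ale_shiftE -(@ale_sraE o (x, 0) (u, xi)).
  have eN xi : silen (sr o *m u, xi + (shiftat o u - shiftat o x))
       - silen (sr o *m x, 0) = silen (u, xi) - silen (x, 0).
    have := @silen_sra o (u, xi) hu uu; have := @silen_sra o (x, 0) hx ux.
    rewrite /sra /= -!/(shiftat _ _) /si_len /= !dotDr !dotNr; lra.
  set d := shiftat o u - shiftat o x in e eN; clearbody d; split=> -[xi0 [h1 h2]].
    exists (xi0 - d); split.
      by move=> xi; rewrite -e h1 opprB addrA.
    by move=> N hN; rewrite -eF; apply: h2; rewrite hN -eN subrK.
  exists (xi0 + d); split.
    by move=> xi; rewrite -[xi](subrK d) e h1 subrK opprD addrA addrAC.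
  by move=> N; rewrite eN eF; apply: h2.
- move=> o x u hx hu ux uu; have eF := F_down hx hu ux uu.
  have e xi : ale (sr o *m x, 0) (u, xi - shiftat o x) <-> ale (x, 0) (u, xi).
    by rewrite -ale_shiftE -(@ale_sralE o (x, 0) (u, xi)).
  have eN xi : silen (u, xi) - silen (x, 0) =
      silen (u, xi - shiftat o x) - silen (sr o *m x, 0) + 1.
    have := @silen_sra o (x, 0) hx ux.
    rewrite /sra /= -!/(shiftat _ _) /si_len /= !dotDr !dotNr; lra.
  split=> -[xi0 [h1 h2]].
    exists (xi0 + shiftat o x); split.
      by move=> xi; rewrite -e h1 opprD addrA addrAC.
    move=> N; rewrite eN addrK => hN.
    have [k hk] := ale_silen (ale_min h1).
    have ek : k%:R = silen (u, xi0) - silen (sr o *m x, 0) by rewrite hk; lra.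
    have -> : N = k.+1.
      by apply/eqP; rewrite -(eqr_nat R) hN -ek -addn1 natrD.
    by rewrite eF (h2 _ ek) expnS mulnCA.
  exists (xi0 - shiftat o x); split.
    by move=> xi; rewrite -[xi](addrK (shiftat o x)) e h1 addrK opprB addrA.
  move=> N hN; have := h2 N.+1; rewrite eN -hN -addn1 natrD => /(_ erefl).
  rewrite eF addn1 expnS mulnCA => /eqP.
  by rewrite eqn_pmul2l // => /eqP.
exists 0; split; first by move=> xi; rewrite subr0.
move=> N; rewrite subrr => /eqP; rewrite pnatr_eq0 => /eqP->.
by rewrite muln1.
Qed.

Lemma edge_len x g : weyl x -> edge x g -> (len (x *m refl g) <= (len x).+1)%N.
Proof.
move=> hx /edgeP[c hw]; have hc := wedge_weight hx hw.
have [/rho_coroot_gt0 h0 _ e] := hw; rewrite -(ler_nat R) -addn1 natrD.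
by case: hc e => ->; lra.
Qed.

Lemma cnt_bound (L : seq 'cV[R]_n) x u : weyl x ->
  ((len x + size L <= len u)%N -> (cnt L x u <= 2 ^ size L)%N) /\
  ((len x + size L < len u)%N -> cnt L x u = 0%N).
Proof.
elim: L x => [|g L IH] x hx.
  rewrite addn0 /=; split=> [_|h]; first by case: (_ == _).
  by case: eqP => // e; rewrite e ltnn in h.
have [IH1 IH2] := IH x hx; rewrite /= addnS; split=> h.
  rewrite IH2 // add0n; case: ifP => // he.
  have [/(_ _) h1 _] := IH _ (edge_weyl hx he).
  rewrite expnS leq_mul2l /= h1 //; apply: leq_trans h.
  by rewrite -addSn leq_add2r edge_len.
rewrite IH2 ?add0n; last exact: ltn_trans (ltnSn _) h.
case: ifP => // he; have [_ ->] := IH _ (edge_weyl hx he); first by rewrite muln0.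
apply: leq_ltn_trans h.
by rewrite -addSn leq_add2r edge_len.
Qed.

Lemma cnt_refl (L : seq 'cV[R]_n) x : (0 < cnt L x x)%N.
Proof.
by elim: L => [|g L IH] /=; [rewrite eqxx|rewrite addn_gt0 IH].
Qed.

(** From 1 to w0 at least size rd steps are needed, so an increasing path uses every
   label and there is at most one. *)
Lemma F11 : F 1%:M 1%:M = 1%N.
Proof.
have [xi0 [h1 h2]] := good_all weyl1 w0_weyl.
have [N hN] := ale_silen (ale_min h1).
have := @ale_rho (1%:M, 0) (w0, xi0) weyl1 (ale_min h1).
rewrite /= dot0r => hr.
have e : F 1%:M w0 = (F 1%:M 1%:M * 2 ^ N)%N by apply: h2; rewrite hN addrC addKr.
have hsz : size rd = len w0 by case: hrd.
have hle : (len w0 <= N)%N.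
  rewrite -(ler_nat R); move: hN; rewrite silen1 dot0r mulr0 add0r => <-.
  by rewrite /si_len /=; lra.
have [/(_ _) hb _] := @cnt_bound (roots rd) 1%:M w0 weyl1.
rewrite len1 add0n size_roots hsz leqnn in hb; have := hb isT.
rewrite e => hb'; apply/eqP; rewrite eqn_leq cnt_refl andbT.
rewrite -(leq_pmul2r (m := 2 ^ N)) ?expn_gt0 // mul1n.
by apply: leq_trans hb' _; rewrite leq_exp2l.
Qed.

(** The distance from x to u in the quantum Bruhat graph, by dist_le and dist_path.  As
   the count equals 2 ^ dist (lemma FE), there is exactly one increasing path and it
   is a shortest path. *)
Definition dist x u : nat := logn 2 (F x u).

Lemma dist_spec x u : weyl x -> weyl u -> exists xi0,
  [/\ forall xi, ale (x, 0) (u, xi) <-> S0 (xi - xi0),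
      silen (u, xi0) = silen (x, 0) + (dist x u)%:R & F x u = (2 ^ dist x u)%N].
Proof.
move=> hx hu; have [xi0 [h1 h2]] := good_all hx hu.
have [N hN] := ale_silen (ale_min h1); exists xi0.
have /(_ _)/esym := h2 N; rewrite F11 mul1n hN addrC addKr => /(_ erefl)/esym e.
have eD : dist x u = N by rewrite /dist e pfactorK.
by rewrite eD.
Qed.

Lemma FE x u : weyl x -> weyl u -> F x u = (2 ^ dist x u)%N.
Proof. by move=> hx hu; have [xi0 []] := dist_spec hx hu. Qed.

Lemma dist_le x p u : weyl x -> weyl u -> qbg_path alpha Phi x p u ->
  (dist x u <= size p)%N.
Proof.
move=> hx hu hp; have [xi0 [h1 h2 _]] := dist_spec hx hu.
have [zeta /h1 /S0_rho] := qbg_ale 0 hx hp.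
rewrite dotDr dotNr => h3 h4; rewrite -(ler_nat R); move: h2 h4.
rewrite /si_len /=; lra.
Qed.

Lemma dist_path x u : weyl x -> weyl u ->
  exists2 p, qbg_path alpha Phi x p u & size p = dist x u.
Proof.
move=> hx hu; have [xi0 [h1 h2 _]] := dist_spec hx hu.
have [p hp] := ale_qbg (hx : weyl (x, 0).1) (ale_min h1); rewrite h2 => hs; exists p => //.
by apply/eqP; rewrite -(eqr_nat R); apply/eqP; lra.
Qed.

Lemma dist_edge x g u : weyl x -> weyl u -> edge x g ->
  (dist x u <= (dist (x *m refl g) u).+1)%N.
Proof.
move=> hx hu he; have hy := edge_weyl hx he.
have [p hp <-] := dist_path hy hu; apply: (@dist_le x (g :: p)) => //=.
by exists (x *m refl g) => //; apply/qbg_wedge => //; apply/edgeP.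
Qed.

Lemma dist_up o x u : weyl x -> weyl u -> up o x -> up o u ->
  dist x (sr o *m u) = (dist x u).+1 /\ dist (sr o *m x) (sr o *m u) = dist x u.
Proof.
move=> hx hu ux uu; have hsx := weyl_srM o hx; have hsu := weyl_srM o hu.
have := F_up hx hu ux uu; rewrite !FE // -expnS.
by move=> -[/eqP + /eqP]; rewrite !eqn_exp2l // => /eqP-> /eqP->.
Qed.

(** * Increasing paths and Bruhat covers *)

Implicit Types (L : seq 'cV[R]_n).

Lemma cnt_mono L1 L2 x u : (cnt L2 x u <= cnt (L1 ++ L2) x u)%N.
Proof.
elim: L1 => //= g L1 IH; exact: leq_trans IH (leq_addr _ _).
Qed.

Lemma cnt_split L1 L2 x u : (0 < cnt (L1 ++ L2) x u)%N ->
  (0 < cnt L2 x u)%N \/ exists La g Lb,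
    [/\ L1 = La ++ g :: Lb, edge x g & (0 < cnt (Lb ++ L2) (x *m refl g) u)%N].
Proof.
elim: L1 => [|g L1 IH] /=; first by left.
rewrite addn_gt0 => /orP[/IH[|[La [g' [Lb [-> h1 h2]]]]]|].
- by left.
- by right; exists (g :: La), g', Lb.
case: ifP => // he; rewrite muln_gt0 /= => h.
by right; exists [::], g, L1.
Qed.

Lemma cnt_ge L x u : weyl x -> weyl u -> (0 < cnt L x u)%N ->
  (2 ^ dist x u <= cnt L x u)%N.
Proof.
move=> + hu; elim: L x => [|g L IH] x hx.
  rewrite /=; case: eqP => // <- _.
  suff -> : dist x x = 0%N by [].
  by apply/eqP; rewrite -leqn0; apply: (@dist_le x [::]).
rewrite /= addn_gt0; case: (posnP (cnt L x u)) => [_|h _].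
  case: ifP => // he /=; rewrite muln_gt0 /= => h.
  apply: leq_trans (leq_addl _ _).
  have := IH _ (edge_weyl hx he) h; rewrite -(leq_pmul2l (m := 2)) // -expnS.
  by apply: leq_trans; rewrite leq_exp2l // dist_edge.
exact: leq_trans (IH x hx h) (leq_addr _ _).
Qed.

Lemma first_label_dist La g Lb x u : weyl x -> weyl u ->
  roots rd = La ++ g :: Lb -> edge x g -> (0 < cnt Lb (x *m refl g) u)%N ->
  (dist (x *m refl g) u < dist x u)%N.
Proof.
move=> hx hu e he h; have hy := edge_weyl hx he.
have := cnt_mono La (g :: Lb) x u; rewrite -e FE //= he => h1.
have := cnt_ge hy hu h; rewrite -(leq_pmul2l (m := 2)) // -expnS => h2.
rewrite -(leq_exp2l (m := 2)) //; apply: leq_trans h2 _.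
exact: leq_trans (leq_addl _ _) h1.
Qed.

Lemma qbg_path_cat p q x y u : qbg_path alpha Phi x p y ->
  qbg_path alpha Phi y q u -> qbg_path alpha Phi x (p ++ q) u.
Proof.
elim: p x => [|g p IH] x /= => [->|[z h1 h2] h3] //.
by exists z => //; apply: IH.
Qed.

Lemma dist_sr_le o x u : weyl x -> weyl u -> up o u ->
  (dist x (sr o *m u) <= (dist x u).+1)%N.
Proof.
move=> hx hu hup; have [p hp <-] := dist_path hx hu.
rewrite -(size_rcons p (u^T *m nr o)); apply: dist_le (weyl_srM o hu) _ => //.
rewrite -cats1; apply: qbg_path_cat hp _; exists (sr o *m u) => //.
by apply/qbg_wedge => //; exists (nc o); apply: wedge_up.
Qed.

(** Descending induction on w = wp t along the word of w0, from w' = s_i w to w.  Lemma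
   cnt_sr turns the increasing path from w to u into one from w' to s_i u, to which
   the induction hypothesis applies; the only Bruhat cover of w that escapes it is w'
   itself.  There, the label with which the increasing path from w' to u starts is
   excluded in all three possible positions: before the label joining w and w', by
   the induction hypothesis; at it, by comparing distances; after it, because there
   would be two increasing paths from w to u. *)
Lemma no_bruhat_cover s t u g : rd = s ++ t -> weyl u ->
  (0 < cnt (roots t) (wp t) u)%N ->
  g \in Pos -> wp t *m g \in Pos -> edge (wp t) g ->
  (dist (wp t) u <= dist (wp t *m refl g) u)%N.
Proof.
elim/last_ind: s t u g => [|s i IH] t u g ers hu hc hg hwg he.
  have := w0_neg hg; case: hrd => <- _.
  by rewrite ers /= hwg.
rewrite cat_rcons in ers; have {}IH := IH _ _ _ ers.
have hit : reduced (i :: t).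
  by have := rd_reduced; rewrite ers => /reduced_catr.
have [ht hb] := reduced_cons hit; have hrs := drop_roots s (i :: t).
set w := wp t in hwg he hc hb *; have hw : weyl w := weyl_word t.
have ow := weyl_orthog hw.
have uw : up (Some i) w by [].
have wtE : wp (i :: t) = sr (Some i) *m w by rewrite word_cons.
have hw' := weyl_srM (Some i) hw.
have wa : w *m (w^T *m nr (Some i)) \in Pos by rewrite orthogKV // alpha_pos.
have uu : up (Some i) u.
  apply: contraT => nu; have hsu := weyl_srM (Some i) hu.
  have := cnt_sr (o := Some i) ht hw hsu uw; rewrite wa srK up_sr // => /(_ nu)[e _].
  by rewrite e in hc.
have hsu := weyl_srM (Some i) hu.
have hc' : (0 < cnt (roots (i :: t)) (wp (i :: t)) (sr (Some i) *m u))%N.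
  have hm := cnt_mono [:: w^T *m alpha i] (roots t) (sr (Some i) *m w) (sr (Some i) *m u).
  rewrite wtE roots_cons; apply: leq_trans hm.
  have := cnt_sr (o := Some i) ht hw hu uw uu; rewrite wa => -[_ ->].
  by rewrite addn_gt0 hc orbT.
have [_ dE] := dist_up hw hu uw uu.
have hz := edge_weyl hw he.
case: (boolP (up (Some i) (w *m refl g))) => uz.
  have he' : edge (wp (i :: t)) g by rewrite wtE edge_flip // uw uz.
  have hg' : wp (i :: t) *m g \in Pos.
    rewrite word_cons -mulmxA; apply: simple_refl_pos hwg _; apply/eqP => e.
    have ez : w *m refl g = sr (Some i) *m w by rewrite -refl_orthog // e.
    by move: uz; rewrite ez up_sr // uw.
  have := IH _ _ hsu hc' hg hg' he'; rewrite wtE dE -mulmxA.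
  by have [_ ->] := dist_up hz hu uz uu.
have eg : w *m g = alpha i := edge_cross hw he uw uz.
have ez : w *m refl g = sr (Some i) *m w by rewrite -refl_orthog // eg.
rewrite ez leqNgt; apply/negP => hlt.
have split0 : roots rd = take (size s) (roots rd) ++ roots (i :: t).
  by rewrite -{1}(cat_take_drop (size s) (roots rd)) ers drop_roots.
have hF : (0 < cnt (take (size s) (roots rd) ++ roots (i :: t)) (sr (Some i) *m w) u)%N.
  by rewrite -split0 FE // expn_gt0.
case: (cnt_split hF) => [|[La [g' [Lb [eL he' hc2]]]]].
  have yE : sr (Some i) *m w *m refl (w^T *m alpha i) = w.
    by rewrite -mulmxA -refl_orthog // orthogKV // (srK (Some i)).
  rewrite roots_cons /= -/w yE addn_gt0 => /orP[h|].
    (* Going from w to w' first gives a second increasing path from w to u. *)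
    have e1 : edge w (w^T *m alpha i) by apply: (edge_up (o := Some i)).
    have := cnt_mono (take (size s) (roots rd)) (roots (i :: t)) w u.
    rewrite -split0 FE // roots_cons /= -/w e1 -refl_orthog // orthogKV //.
    have := cnt_ge hw hu hc; have := expn_gt0 2 (dist w u) => /= h1 h2.
    move: h h1 h2; clear; lia.
  (* The increasing path from w' starts by returning to w. *)
  case: ifP => // e1 h.
  have := cnt_mono (take (size s) (roots rd)) (roots (i :: t)) (sr (Some i) *m w) u.
  rewrite -split0 FE // roots_cons /= -/w e1 yE => h1.
  have := cnt_ge hw hu hc; rewrite -(leq_pmul2l (m := 2)) // -expnS => h2.
  have h3 := leq_trans h2 (leq_trans (leq_addl _ _) h1).
  move: h3; rewrite leq_exp2l // => h3.
  by have := ltn_trans hlt h3; rewrite ltnn.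
(* A label before those of w' is not an inversion of w', so g' is a Bruhat edge. *)
have hpos : g' \in Pos /\ wp (i :: t) *m g' \in Pos.
  have ur := roots_uniq rd_reduced; rewrite split0 eL in ur.
  have hg' : g' \in Pos.
    apply: (roots_pos rd_reduced); rewrite split0 eL.
    by rewrite !mem_cat mem_head orbT.
  split=> //; rewrite -[_ \in _]negbK -mem_roots //.
  move: ur; rewrite cat_uniq => /and3P[_ /hasPn h _]; apply/negP => /h.
  by rewrite /= mem_cat mem_head orbT.
have [hg' hwg'] := hpos.
have split1 : roots rd = La ++ g' :: (Lb ++ roots (i :: t)).
  by rewrite split0 eL -catA.
have h1 := first_label_dist hw' hu split1 he' hc2.
have he1 := he'; rewrite -wtE in he'.
have := IH _ _ hsu hc' hg' hwg' he'; rewrite wtE dE.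
have := dist_sr_le (edge_weyl hw' he1) hu uu.
move: hlt h1; clear; lia.
Qed.

(** * Bruhat order and semi-infinite order *)

Lemma descent_ex v : weyl v -> (0 < len v)%N -> exists i, ~~ up (Some i) v.
Proof.
move=> hv; have [[|i s] [<- hs]] := reduced_ex hv; first by rewrite -hs.
move=> _; exists i; have [h1 h2] := reduced_cons (esym hs).
by rewrite word_cons (up_sr (Some i) (weyl_word s)) h2.
Qed.

(** A reflection raising the length is refined to a chain of covers by induction on the
   length of v: a descent i of v is either one of u, and both are lowered, or an
   ascent of u, and v alone is lowered while u is raised. *)
Lemma bruhat_step_ale u v b : weyl u -> b \in Pos -> v = refl b *m u ->
  (len u < len v)%N -> ale (u, 0) (v, 0).
Proof.
move: {2}(len v) (leqnn (len v)) => N; elim: N u v b => [|N IH] u v b hN hu hb ev hl.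
  by move: hl; rewrite ltnNge (leq_trans hN).
have hv : weyl v by rewrite ev; apply: weylM hu; apply/weyl_refl/pos_root.
have [i uv] := descent_ex hv (leq_ltn_trans (leq0n _) hl).
have ou := weyl_orthog hu; have hsu := weyl_srM (Some i) hu.
have hsv := weyl_srM (Some i) hv; have len_v := len_simple_down hv uv.
have sraE x : sra (Some i) (x, 0) = (sr (Some i) *m x, 0).
  by rewrite /sra /= scale0r addr0.
have usv : up (Some i) (sr (Some i) *m v) by rewrite up_sr.
have [eb|nb] := eqVneq b (alpha i).
  have ev' : v = sr (Some i) *m u by rewrite ev eb.
  rewrite ev' -sraE; apply/ale1/aedge_up => //=.
  by move: uv; rewrite ev' (up_sr (Some i) hu) negbK.
have hsb := simple_refl_pos hb nb.
have ev1 : sr (Some i) *m v = refl (sr (Some i) *m b) *m (sr (Some i) *m u).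
  rewrite ev !mulmxA refl_orthog //; exact: weyl_orthog (weyl_sr (Some i)).
have hN1 : (len (sr (Some i) *m v) <= N)%N by rewrite -ltnS -len_v.
case: (boolP (up (Some i) u)) => uu; last first.
  have len_u := len_simple_down hu uu.
  have hl1 : (len (sr (Some i) *m u) < len (sr (Some i) *m v))%N.
    by rewrite -ltnS -len_v -len_u.
  have usu : up (Some i) (sr (Some i) *m u) by rewrite up_sr.
  have a := IH _ _ _ hN1 hsu hsb ev1 hl1.
  have := @ale_sra (Some i) (sr (Some i) *m u, 0) (sr (Some i) *m v, 0) hsu a usu usv.
  by rewrite 2!sraE (srK (Some i) u) (srK (Some i) v).
have hg : u^T *m b \in Pos.
  rewrite -[_ \in _]negbK -negE; last exact: weyl_rootT hu (pos_root hb).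
  apply/negP => hn; have := len_refl_lt hu hn.
  rewrite mulmxN orthogKV // reflN -refl_orthog // orthogKV // -ev posN //.
  by move=> /(_ isT) h; move: (ltn_trans hl h); rewrite ltnn.
have hl1 : (len (sr (Some i) *m u) < len (sr (Some i) *m v))%N.
  have := len_refl_gt hsu hg; rewrite -!mulmxA -refl_orthog // orthogKV //.
  by rewrite -ev; apply.
have a1 : ale (u, 0) (sr (Some i) *m u, 0) by rewrite -sraE; apply/ale1/aedge_up.
have a2 : ale (sr (Some i) *m v, 0) (v, 0).
  by rewrite -{2}(srK (Some i) v) -[X in ale _ X]sraE; apply/ale1/aedge_up.
exact: ale_trans a1 (ale_trans (IH _ _ _ hN1 hsu hsb ev1 hl1) a2).
Qed.

Lemma bruhat_ale u v : weyl u -> bruhat_lt alpha Phi u v ->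
  [/\ weyl v, (len u < len v)%N & ale (u, 0) (v, 0)].
Proof.
move=> + h; elim: h => {u v} [u v [b hb [e hl]]|u v z _ IH1 _ IH2] hu.
  split=> //; last exact: bruhat_step_ale hb e hl.
  by rewrite e; apply: weylM hu; apply/weyl_refl/pos_root.
have [hv l1 a1] := IH1 hu; have [hz l2 a2] := IH2 hv.
by split=> //; [apply: ltn_trans l1 l2|apply: ale_trans a1 a2].
Qed.

(** * Label-increasing paths as index sequences *)

Lemma edge_qbg x g y : weyl x -> qbg_edge alpha Phi x g y -> edge x g /\ y = x *m refl g.
Proof.
move=> hx /(qbg_wedge g y hx)[c hw]; have [_ e _] := hw.
by split=> //; apply/edgeP; exists c; rewrite -e.
Qed.

Lemma cnt_drop L k x u : (cnt (drop k L) x u <= cnt L x u)%N.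
Proof. by rewrite -{2}(cat_take_drop k L) cnt_mono. Qed.

Lemma increasing_cnt L ls k x u : weyl x -> sorted ltn ls ->
  all (fun l => l < size L)%N ls -> (if ls is l :: _ then k <= l else true)%N ->
  qbg_path alpha Phi x [seq nth 0 L l | l <- ls] u -> (0 < cnt (drop k L) x u)%N.
Proof.
elim: ls k x => [|l ls IH] k x hx /=.
  by move=> _ _ _ ->; apply: cnt_refl.
move=> hs /andP[hj ha] hk [y /(edge_qbg hx)[he ->] hp].
have h1 : (0 < cnt (drop l.+1 L) (x *m refl (nth 0%R L l)) u)%N.
  apply: IH => //; [exact: edge_weyl|exact: path_sorted hs|].
  by case: ls hs {ha hp} => //= l' ls /andP[].
have := cnt_drop (drop k L) (l - k) x u; rewrite drop_drop subnK //.
by rewrite (drop_nth 0) //= he; apply: leq_trans; rewrite addn_gt0 muln_gt0 h1 orbT.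
Qed.

Lemma cnt_increasing L x u : weyl x -> (0 < cnt L x u)%N -> exists ls,
  [/\ sorted ltn ls, all (fun l => l < size L)%N ls,
      qbg_path alpha Phi x [seq nth 0 L l | l <- ls] u
    & (2 ^ size ls <= cnt L x u)%N].
Proof.
have srt (l : nat) ls : path ltn l ls -> path ltn l.+1 (map succn ls).
  by elim: ls l => //= l' ls IH l /andP[h /IH ->]; rewrite ltnS h.
have srt0 ls : sorted ltn ls -> path ltn 0 (map succn ls).
  by case: ls => //= l ls /srt.
have alls k ls : all (fun l => l < k)%N ls -> all (fun l => l < k.+1)%N (map succn ls).
  by rewrite all_map.
elim: L x => [|g L IH] x hx /=.
  by case: eqP => // <- _; exists [::].
rewrite addn_gt0; case: (posnP (cnt L x u)) => [_|h _].
  case: ifP => // he /=; rewrite muln_gt0 /= => h.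
  have [ls [h1 h2 h3 h4]] := IH _ (edge_weyl hx he) h.
  exists (0%N :: map succn ls); split.
  - exact: srt0.
  - by rewrite /= alls.
  - rewrite /=; exists (x *m refl g); first by apply/qbg_wedge => //; apply/edgeP.
    by rewrite -map_comp.
  - apply: leq_trans (leq_addl _ _).
    by rewrite /= size_map expnS leq_mul2l.
have [ls [h1 h2 h3 h4]] := IH _ hx h; exists (map succn ls); split.
- exact: path_sorted (srt0 _ h1).
- exact: alls.
- by rewrite -map_comp.
- by rewrite size_map; apply: leq_trans h4 (leq_addr _ _).
Qed.

(** * Comparison of the two sets *)

Lemma edge_bruhat x g c : weyl x -> x *m g \in Pos ->
  wedge g c x (x *m refl g) -> c = 0.
Proof.
move=> hx hxg hw; case: (wedge_weight hx hw) => // ec.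
have [hg _ e] := hw; have := len_refl_gt hx hg hxg.
rewrite -(ler_nat R) -natr1 => h1; have h2 := rho_coroot_gt0 hg.
have : dot rho (coroot g) <= 0 by move: e; rewrite ec mulr1; lra.
by rewrite leNgt h2.
Qed.

Lemma si_up_ale x Y : weyl x -> si_up alpha Phi (x, 0) Y <->
  (weyl_af alpha Y /\ ale (x, 0) Y).
Proof.
by move=> hx; split=> -[h1 h2]; split=> //; apply/(@si_leP (x, 0)).
Qed.

(** An increasing path from w to u exists.  If it started with a label outside of
   roots t, its first edge would lead to a Bruhat cover z of w on a shortest path, and
   everything above w in the fiber of u would be above z. *)
Lemma Kset_cnt s t u xi : rd = s ++ t -> weyl u ->
  Kset alpha Phi (wp t) (u, xi) -> (0 < cnt (roots t) (wp t) u)%N.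
Proof.
move=> ers hu [/(si_up_ale _ (weyl_word t))[haf hle] hn].
have hw := weyl_word t; have hrs := drop_roots s t; rewrite -ers in hrs.
have split0 : roots rd = take (size s) (roots rd) ++ roots t.
  by rewrite -hrs cat_take_drop.
have hF : (0 < cnt (take (size s) (roots rd) ++ roots t) (wp t) u)%N.
  by rewrite -split0 FE // expn_gt0.
case: (cnt_split hF) => // -[La [g [Lb [eL he hc]]]]; case: hn.
have split1 : roots rd = La ++ g :: (Lb ++ roots t) by rewrite split0 eL -catA.
have hd := first_label_dist hw hu split1 he hc.
have hg : g \in Pos by apply: (roots_pos rd_reduced); rewrite split1 mem_cat mem_head orbT.
have hwg : wp t *m g \in Pos.
  have ht : reduced t by have := rd_reduced; rewrite ers => /reduced_catr.
  have ur := roots_uniq rd_reduced; rewrite split0 eL in ur.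
  rewrite -[_ \in _]negbK -mem_roots //.
  move: ur; rewrite cat_uniq => /and3P[_ /hasPn h _]; apply/negP => /h.
  by rewrite /= mem_cat mem_head orbT.
have hz := edge_weyl hw he; have hl := len_refl_gt hw hg hwg.
exists (wp t *m refl g).
  split=> //; apply: t_step; exists (wp t *m g).
    apply/posP; split; first exact: weyl_root (pos_root hg).
    by case/posP: hwg.
  by split=> //; rewrite refl_orthog //; apply: word_orthog.
apply/si_up_ale => //; split=> //.
have [xi0 [h1 h2 _]] := dist_spec hw hu.
have [zeta [h3 h4 _]] := dist_spec hz hu.
have [c hwe] := edgeP _ _ he; have c0 := edge_bruhat hw hwg hwe.
have a1 : aedge (wp t, 0) (wp t *m refl g, 0).
  by exists g, c; rewrite c0 /= scale0r addr0; split=> //; rewrite -c0.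
have a2 : ale (wp t, 0) (u, zeta) := ale_step a1 (ale_min h3).
have hS := (h1 _).1 a2; have e1 := aedge_silen a1.
(* A shortest path from w to u passes through the cover, so both have the same minimal
   weight at u. *)
have e0 : zeta - xi0 = 0.
  apply: S0_eq0 hS _; rewrite dotDr dotNr.
  have hd' : (dist (wp t *m refl g) u)%:R + 1 <= (dist (wp t) u)%:R :> R.
    by rewrite natr1 ler_nat.
  move: h4 h2 e1; rewrite /si_len /=. lra.
have ez : zeta = xi0 by apply/eqP; rewrite -subr_eq0 e0.
by apply/h3; rewrite ez; apply/h1.
Qed.

Lemma ale_first X Y : ale X Y -> X <> Y -> exists2 Z, aedge X Z & ale Z Y.
Proof. by case=> // {}X Z {}Y h1 h2 _; exists Z. Qed.

(** The minimal weight xi0 works: a z above w in Bruhat order and below (u, xi0) would put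
   a Bruhat cover of w on a shortest path from w to u. *)
Lemma cnt_Kset s t u : rd = s ++ t -> weyl u ->
  (0 < cnt (roots t) (wp t) u)%N ->
  exists2 xi, coroot_lattice alpha xi & Kset alpha Phi (wp t) (u, xi).
Proof.
move=> ers hu hc; have hw := weyl_word t.
have [xi0 [h1 h2 _]] := dist_spec hw hu; have hmin := ale_min h1.
have hlat : coroot_lattice alpha xi0 := ale_lattice hmin lattice0.
exists xi0 => //; split; first by apply/si_up_ale.
case=> z [hz hwz] /(si_up_ale _ hz)[_ hle].
have [_ hlen a1] := bruhat_ale hw hwz.
have [Y hY a2] : exists2 Y, aedge (wp t, 0) Y & ale Y (z, 0).
  by apply: ale_first a1 _ => -[e]; rewrite e ltnn in hlen.
have hy := aedge_weyl (hw : weyl (wp t, 0).1) hY.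
have eS := aedge_silen hY.
case: Y hY a2 hy eS => y eta [g [c [/= hwe e]]] a2 hy eS.
have [hg ey _] := hwe; have hr := ale_rho (hy : weyl (y, eta).1) a2.
have c0 : c = 0.
  case: (wedge_weight hw hwe) => // ec; move: hr.
  by rewrite e ec /= add0r scale1r dot0r leNgt rho_coroot_gt0.
have he : edge (wp t) g by apply/edgeP; exists c; rewrite -ey.
have hwg : wp t *m g \in Pos by move: (wedge_apos hw hwe); rewrite c0 /apos eqxx.
have := no_bruhat_cover ers hu hc hg hwg he; rewrite -ey leqNgt; case/negP.
have [p hp hs] := ale_qbg (hy : weyl (y, eta).1) (ale_trans a2 hle).
have hd := dist_le hy hu hp; apply: leq_ltn_trans hd _.
rewrite -(ltr_nat R); have [xi1 [h3 h4 _]] := dist_spec hw hu.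
have := S0_rho ((h1 _).1 (ale_min h3)); rewrite dotDr dotNr.
have := S0_rho ((h3 _).1 hmin); rewrite dotDr dotNr.
move: eS hs h4; rewrite /si_len /=; lra.
Qed.

Lemma EQB_cnt s t u : rd = s ++ t ->
  EQB alpha Phi s t (wp t) u <-> weyl u /\ (0 < cnt (roots t) (wp t) u)%N.
Proof.
move=> ers; have hw := weyl_word t; have hrs := drop_roots s t.
split=> [[hu [ls [hsort hall [hp _]] hfirst]]|[hu hc]].
  split=> //; rewrite -hrs; apply: increasing_cnt hp => //.
    by rewrite size_roots.
  by case: (ls) hfirst.
split=> //; have [ls [h1 h2 h3 h4]] := cnt_increasing hw hc.
have nthE k : nth 0 (roots (s ++ t)) (size s + k) = nth 0 (roots t) k.
  by rewrite -nth_drop hrs.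
exists (map (addn (size s)) ls); last first.
  by case: ls {h1 h2 h3 h4} => //= k ls; rewrite leq_addr.
split.
- case: ls h1 {h2 h3 h4} => //= k ls; elim: ls k => //= k' ls IH k /andP[hk /IH ->].
  by rewrite ltn_add2l hk.
- rewrite all_map; apply: sub_all h2 => k /=.
  by rewrite size_cat ltn_add2l size_roots.
split.
  by rewrite -map_comp (eq_map (g := fun k => nth 0 (roots t) k)).
move=> q hq; have hd := dist_le hw hu hq; apply: leq_trans hd.
rewrite !size_map -(leq_exp2l (m := 2)) // -FE //; apply: leq_trans h4 _.
by rewrite -hrs -ers cnt_drop.
Qed.

End Weyl.

Theorem lemma4p21 (R : realFieldType) (n : nat)
    (Phi : seq 'cV[R]_n) (alpha : 'I_n -> 'cV[R]_n)
    (hPhi : root_system Phi) (hirr : irreducible_root_system Phi)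
    (hbase : root_base alpha Phi)
    (w w0 : 'M[R]_n) (hw : weyl alpha w) (hw0 : longest alpha w0)
    (pre red : seq 'I_n)
    (hred : reduced_expr alpha w red)
    (hpre : reduced_expr alpha w0 (pre ++ red)) :
  fin_part alpha (Kset alpha Phi w) = EQB alpha Phi pre red w.
Proof.
have [th [m hth]] := affine_highest_ex hPhi hbase hw0 hirr.
have [<- _] := hred; apply/seteqP; split=> u.
  case=> hu [xi _ hK]; apply/(EQB_cnt hPhi hbase hw0 hth hpre) => //; split=> //.
  exact: (Kset_cnt hPhi hbase hw0 hth hpre) hK.
move=> /(EQB_cnt hPhi hbase hw0 hth hpre)[] // hu hc; split=> //.
exact: (cnt_Kset hPhi hbase hw0 hth hpre) hc.
Qed.
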